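(* For every $\beta > 0$ and $\delta > 0$, there exists $C > 0$ such that the following holds. Let $A \subset \mathbb{Z}^n$ be a two-cube with differences $d_1,\ldots,d_n$. Let $B \subseteq \{\pm 1\}^n$ be of size $2^{\beta n}$. Let $Y$ be uniformly distributed in $B$. (1) For all but $2^{n(1-\beta+\delta)}$ directions $x \in A$, $$\max_{k \in \mathbb{Z}} \Pr_Y[\langle x, Y\rangle = k] \leq C \sqrt{\ln(n)}\, n^{-0.5}.$$ (2) If $d_1,\ldots,d_n$ are distinct, then for all but $2^{n(1-\beta+\delta)}$ directions $x \in A$, $$\max_{k \in \mathbb{Z}} \Pr_Y[\langle x, Y\rangle = k] \leq C \sqrt{\ln(n)}\, n^{-1.5}.$$ (3) If $\{d_1,\ldots,d_n\}$ is a weak Sidon set of size $n$, then for all but $2^{n(1-\beta+\delta)}$ directions $x \in A$, $$\max_{k \in \mathbb{Z}} \Pr_Y[\langle x, Y\rangle = k] \leq C \sqrt{\ln(n)}\, n^{-2.5}.$$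
   Context: $\langle x, y\rangle = \sum_{j=1}^n x_j y_j$. A set $A \subset \mathbb{Z}^n$ is a two-cube if $A = A_1 \times A_2 \times \cdots \times A_n$, where each $A_j = \{u_j, v_j\}$ consists of two distinct integers. The differences of $A$ are the numbers $d_j = u_j - v_j$ for $j \in [n] = \{1,\ldots,n\}$. A set $S \subset \mathbb{Z}$ of size $n$ is a weak Sidon set if the number of solutions to the equation $\epsilon_1 s_1 + \epsilon_2 s_2 = \epsilon_3 s_3 + \epsilon_4 s_4$ for $\epsilon_1,\ldots,\epsilon_4 \in \{\pm 1\}$ and $s_1,\ldots,s_4 \in S$ is at most $100 n^2$.
   Formalization: The theorem is proved for n ≥ 2: at n = 1 the bound is 0 since ln(1) = 0, and the claim fails (β = 1, δ = 1/2, B = {±1}: both directions are exceptional but only 2^{1/2} are allowed); at n = 0 ln(n) is undefined. *)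

(* Defs.v *)
From mathcomp Require Import all_boot all_order all_algebra finmap.
From mathcomp Require Import all_classical all_reals all_analysis.

Set Implicit Arguments.
Unset Strict Implicit.
Unset Printing Implicit Defensive.

Import Order.TTheory GRing.Theory Num.Theory.

Local Open Scope fset_scope.
Local Open Scope ring_scope.

Definition dot n (x y : 'rV[int]_n) : int := \sum_(j < n) x 0 j * y 0 j.

(* The endpoints u, v are part of the data: swapping u j and v j leaves A
   unchanged but flips the sign of the j-th difference. *)
Definition two_cube n (A : {fset 'rV[int]_n}) (u v : 'I_n -> int) : Prop :=
  (forall j, u j != v j) /\
  (forall x, (x \in A) = [forall j, x 0 j \in [fset u j; v j]]).

Definition difference n (u v : 'I_n -> int) (j : 'I_n) : int := u j - v j.

Definition signs : {fset int} := [fset 1; -1].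

Definition sign_vectors n (B : {fset 'rV[int]_n}) : Prop :=
  forall y, y \in B -> forall j, y 0 j \in signs.

(* Solutions are counted as 8-tuples (signs and elements), so different tuples
   with the same signed values e_i * s_i count separately. *)
Definition sidon_solutions (S : {fset int}) :=
  [set p : (signs * signs * signs * signs) * (S * S * S * S) |
    let: ((e1, e2, e3, e4), (s1, s2, s3, s4)) := p in
    val e1 * val s1 + val e2 * val s2 == val e3 * val s3 + val e4 * val s4]%SET.

Definition weak_sidon (S : {fset int}) : Prop :=
  (#|sidon_solutions S| <= 100 * #|` S| ^ 2)%N.

Definition uniform_prob (R : realType) (T : choiceType) (B : {fset T})
    (E : pred T) : R :=
  #|` [fset y in B | E y]|%:R / #|` B|%:R.

(* The supremum is attained, see max_dot_probP. *)
Definition max_dot_prob (R : realType) n (B : {fset 'rV[int]_n})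
    (x : 'rV[int]_n) : R :=
  sup (range (fun k : int => uniform_prob R B (fun y => dot x y == k))).

Lemma max_dot_probP (R : realType) n (B : {fset 'rV[int]_n}) x :
  (exists k : int,
     max_dot_prob R B x = uniform_prob R B (fun y => dot x y == k)) /\
  (forall k : int,
     uniform_prob R B (fun y => dot x y == k) <= max_dot_prob R B x).
Proof.
pose c k := #|` [fset y in B | dot x y == k]|.
have cB k : (c k <= #|` B|)%N.
  by apply: fsubset_leq_card; apply/fsubsetP => y; rewrite !inE => /andP[].
pose P m := `[< exists k, c k = m >].
have exP : exists m, P m by exists (c 0); apply/asboolP; exists 0.
have leP m : P m -> (m <= #|` B|)%N by move=> /asboolP[k <-].
case: (ex_maxnP exP leP) => _ /asboolP[k0 <-] maxk0.
pose p k := uniform_prob R B (fun y => dot x y == k).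
have pmax k : p k <= p k0.
  rewrite /p /uniform_prob ler_wpM2r ?invr_ge0 ?ler0n// ler_nat.
  by apply: maxk0; apply/asboolP; exists k.
suff -> : max_dot_prob R B x = p k0 by split => //; exists k0.
apply/eqP; rewrite eq_le; apply/andP; split.
  by apply: ge_sup; [exists (p k0), k0 | move=> _ [k _ <-]; exact: pmax].
by apply: ub_le_sup; [exists (p k0) => _ [k _ <-]; exact: pmax | exists k0].
Qed.

Definition exceptional (R : realType) n (A B : {fset 'rV[int]_n}) (t : R) :
    {fset 'rV[int]_n} :=
  [fset x in A | ~~ (max_dot_prob R B x <= t)].

(* Main.v *)
Require Import Defs.
From mathcomp Require Import all_boot all_order all_algebra finmap.
From mathcomp Require Import ring lra zify.
From mathcomp Require Import all_classical all_reals all_analysis.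

Import Order.TTheory GRing.Theory Num.Theory.

Local Open Scope fset_scope.
Local Open Scope ring_scope.

(** Let E be the exceptional set and suppose that it has more than
    2^(n(1-beta+delta)) elements, so that |E||B| >= 2^((1+delta)n).  For a large
    prime p, Fourier inversion on F_p bounds the probability that <x,Y> = k by
    the average over a in F_p of |f_a(x)|, with f_a(x) = E_Y e(a<x,Y>/p)
    ([prob_le_char]).  It is enough to bound the average of |f_a(x)| over x in E
    and a in F_p.

    Reveal Y from the first coordinate to the last, and x, uniform in E, from the
    last coordinate to the first.  Call a coordinate balanced for y, or for x, if
    both of its values have conditional probability at least kappa given what is
    already revealed.  As |E||B| exceeds 2^n by an exponential factor, for all
    but an exponentially small proportion of the pairs (x,y) the set J of the
    coordinates balanced for both has at least kappa n elements
    ([few_common_balanced]).  The set J depends on the pair but not on the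
    frequency a, and this makes the final integration over a possible.

    For one frequency, splitting on the first coordinate gives
    f(x) = q1 e(t x_1) f1(x') + q0 e(-t x_1) f0(x').  At a balanced node of y there is
    a gain unless the two terms are aligned.  Since t^(1+eta) is strictly convex,
    the gain can be kept multiplicative even if |f1| and |f0| are very different
    ([two_point]), at the price of a factor eta, which gives
    |f(x)|^(1+eta) <= E_Y exp(-c eta loss(x,Y)) ([char_norm_powR_le]).  Changing
    x_1 from u_1 to v_1 rotates the angle between the two terms by an amount that
    depends only on a and d_1, so that a balanced x_1 makes the expected loss at
    least a multiple of 1 - cos(4 pi a d_1 / p).  By an exponential moment
    estimate ([suffix_compensator]) the loss is then, up to O(ln n) and outside
    an event of polynomially small probability, at least a multiple of
    D_J(a) = sum_{j in J} (1 - cos(4 pi a d_j / p)).  With eta of order 1/ln n all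
    the truncations cost constants, and the average of |f_a(x)| is at most a
    constant times the average of exp(- (c/ln n) D_J(a)), up to n^(-4)
    ([char_norm_average_le]).  The factor 1/ln n is the source of sqrt(ln n).

    The average over a is treated as in Halasz's theorem.  The level sets T_L of
    D_J satisfy T_L + T_L in T_{4L}, so the Cauchy-Davenport theorem gives
    |T_L| <= 1 + 2^(-k) |T_{4^k L}| as long as 4^k L < |J|, and summation over dyadic levels
    gives an average of order sqrt(ln n / n) times the density of T_{|J|/4}
    ([sum_expR_dispersion]).  On T_{|J|/4} the sum of the cosines is at least
    3|J|/4; its moments bound the density by a constant times n^(-r), with r = 0
    in general, r = 1 by the second moment if the differences are distinct
    ([card_level_uniq]), and r = 2 by the fourth moment, which counts Sidon
    solutions ([card_level_sidon]). *)

Section HalaszTwoCubes.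

Variable R : realType.
Implicit Types (w v : seq bool -> R) (phi : seq R).

(** * Strict convexity of the power 1 + eta at two complex numbers *)

Lemma expRN_le (t : R) : 0 <= t <= 2 -> expR (- t) <= 1 - t / 3.
Proof.
move=> /andP[t0 t2].
have h : 1 + t <= expR t by exact: expR_ge1Dx.
rewrite expRN -div1r ler_pdivrMr ?expR_gt0//.
apply: (@le_trans _ _ ((1 - t / 3) * (1 + t))); first by nra.
by apply: ler_wpM2l => //; lra.
Qed.

(** From t^eta >= 1 + eta ln t and ln t = 2 ln (sqrt t) >= 2 (1 - 1 / sqrt t).
    After averaging, the right-hand terms form a Hellinger distance, which is
    easier to handle than a relative entropy. *)
Lemma powR_ge_hellinger (eta t : R) : 0 <= eta -> 0 <= t ->
  t + eta * (2 * t - 2 * Num.sqrt t) <= t `^ (1 + eta).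
Proof.
move=> e0 t_ge0; have [<-|t_neq0] := eqVneq 0 t.
  by rewrite sqrtr0 mulr0 subrr mulr0 addr0 powR_ge0.
have t0 : 0 < t by rewrite lt_def eq_sym t_neq0.
have s0 : 0 < Num.sqrt t by rewrite sqrtr_gt0.
have st : Num.sqrt t ^+ 2 = t by rewrite sqr_sqrtr ?ltW.
rewrite powRD; last by rewrite (gt_eqF t0) implybT.
rewrite powRr1// /powR (gt_eqF t0) /=.
have lnt : ln t = 2 * ln (Num.sqrt t) by rewrite -[in LHS]st lnXn// mulr_natl.
have lns : 1 - (Num.sqrt t)^-1 <= ln (Num.sqrt t).
  have := @le_ln1Dx R ((Num.sqrt t)^-1 - 1).
  rewrite subrKC lnV ?posrE//.
  have : 0 < (Num.sqrt t)^-1 by rewrite invr_gt0.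
  move=> h h2; have := h2 ltac:(lra); lra.
have h1 : 1 + eta * ln t <= expR (eta * ln t) by exact: expR_ge1Dx.
apply: (@le_trans _ _ (t * (1 + eta * ln t))); last by rewrite ler_wpM2l// ltW.
rewrite [t * (1 + _)]mulrDr mulr1 lerD2l [t * _]mulrCA ler_wpM2l// lnt.
apply: (@le_trans _ _ (t * (2 * (1 - (Num.sqrt t)^-1)))); last first.
  by rewrite ler_wpM2l ?ler_wpM2l// ltW.
suff -> : t * (2 * (1 - (Num.sqrt t)^-1)) = 2 * t - 2 * Num.sqrt t by [].
by move: s0 st; move: (Num.sqrt t) => r r0 <-; field; exact: lt0r_neq0.
Qed.

(** If a is at least b, the denominators are at most a^2, and with r = b / a the
    claim follows from (1 - r)^2 + r^2 >= 1 / 2: either a and b are far apart, or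
    their product is large. *)
Lemma two_point_gain (p q a b s : R) : 0 <= p -> 0 <= q -> p + q = 1 ->
  0 <= a -> 0 <= b -> 0 < p * a ^+ 2 + q * b ^+ 2 -> 0 <= s <= 1 ->
  s / 2 <= (a - b) ^+ 2 / (p * a ^+ 2 + q * b ^+ 2) +
    s * (a ^+ 2 * b ^+ 2) / (p * a ^+ 2 + q * b ^+ 2) ^+ 2.
Proof.
move=> p0 q0 pq a0 b0 m0 /andP[s0 s1].
set m := _ + _ in m0 *.
wlog ab : p q a b p0 q0 pq a0 b0 @m m0 / b <= a.
  move=> W; have [ab|/ltW ab] := leP b a; first exact: W.
  have := W q p b a q0 p0; rewrite addrC => /(_ pq b0 a0).
  rewrite addrC -/m => /(_ m0 ab).
  by rewrite -sqrrN opprB [b ^+ 2 * _]mulrC.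
have mle : m <= a ^+ 2.
  rewrite /m; have : b ^+ 2 <= a ^+ 2 by rewrite ler_sqr ?nnegrE.
  by have -> : p = 1 - q; [lra | nra].
have m_ge0 := ltW m0.
have a2 : 0 < a ^+ 2 by exact: lt_le_trans mle.
have -> : (a - b) ^+ 2 / m + s * (a ^+ 2 * b ^+ 2) / m ^+ 2 =
  ((a - b) ^+ 2 * m + s * (a ^+ 2 * b ^+ 2)) / m ^+ 2 by field; exact: lt0r_neq0.
rewrite ler_pdivlMr ?exprn_gt0//.
have h1 : m ^+ 2 <= m * a ^+ 2 by rewrite expr2 ler_wpM2l// ltW.
have h2 : s * (m * b ^+ 2) <= s * (a ^+ 2 * b ^+ 2).
  by rewrite ler_wpM2l// ler_wpM2r// sqr_ge0.
have h3 : s * (m * (a - b) ^+ 2) <= m * (a - b) ^+ 2.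
  by rewrite ler_piMl// mulr_ge0 ?sqr_ge0.
have h4 : s * m * (a ^+ 2 / 2) <= s * m * ((a - b) ^+ 2 + b ^+ 2).
  apply: ler_wpM2l; [by rewrite mulr_ge0 | have := sqr_ge0 (a - 2 * b); nra].
have h5 : s / 2 * m ^+ 2 <= s / 2 * (m * a ^+ 2) by rewrite ler_wpM2l ?divr_ge0.
nra.
Qed.

(** Here M is the modulus of p z1 + q z2 with |z1| = a, |z2| = b, and t is one
    minus the cosine of the angle between z1 and z2.  If a and b are comparable,
    the gain comes from the angle; if not, from the strict convexity of the power
    1 + eta, of order eta.  So the gain eta p q t holds in all cases. *)
Lemma two_point (p q a b M t eta : R) :
  0 <= p -> 0 <= q -> p + q = 1 -> 0 <= a -> 0 <= b -> 0 <= M ->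
  0 <= t <= 2 -> 0 <= eta <= 1 ->
  M ^+ 2 = (p * a + q * b) ^+ 2 - 2 * (p * q * (a * b)) * t ->
  M `^ (1 + eta) <= expR (- (eta * (p * q) * t / 8)) *
                    (p * a `^ (1 + eta) + q * b `^ (1 + eta)).
Proof.
move=> p0 q0 pq a0 b0 M0 /andP[t0 t2] /andP[e0 e1] HM.
set m := p * a + q * b in HM.
have m_ge0 : 0 <= m by rewrite addr_ge0 ?mulr_ge0.
have [m_eq0|m_neq0] := eqVneq m 0.
  have -> : M = 0.
    apply/eqP; rewrite -sqrf_eq0 -[_ == 0]andbT eq_le sqr_ge0 andbT HM m_eq0.
    by rewrite expr0n/= sub0r oppr_le0 !mulr_ge0.
  rewrite powR0 ?gt_eqF ?ltr_pwDl//.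
  by rewrite mulr_ge0 ?expR_ge0 ?addr_ge0 ?mulr_ge0 ?powR_ge0.
have m0 : 0 < m by rewrite lt_def m_neq0.
have eta_gt0 : 0 < 1 + eta by rewrite ltr_pwDl.
set A := Num.sqrt a; set B := Num.sqrt b.
have A0 : 0 <= A by exact: sqrtr_ge0.
have B0 : 0 <= B by exact: sqrtr_ge0.
have AE : A ^+ 2 = a by rewrite sqr_sqrtr.
have BE : B ^+ 2 = b by rewrite sqr_sqrtr.
have pq0 : 0 <= p * q by rewrite mulr_ge0.
(* x is the gain from the angle and y the gain from convexity. *)
pose x := p * q * (a * b) * t / m ^+ 2.
pose y := eta * (p * q * (A - B) ^+ 2 / m).
have m2_gt0 : 0 < m ^+ 2 by rewrite exprn_gt0.
have x0 : 0 <= x by rewrite /x !mulr_ge0// invr_ge0; exact: ltW.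
have HM' : M ^+ 2 = m ^+ 2 * (1 - 2 * x).
  by rewrite HM /x; field; exact: lt0r_neq0.
have x1 : 0 <= 1 - 2 * x.
  by rewrite -(pmulr_rge0 _ m2_gt0) -HM' sqr_ge0.
have g0 : 0 <= p * q * (A - B) ^+ 2 / m.
  by apply: divr_ge0 => //; apply: mulr_ge0 => //; exact: sqr_ge0.
have y0 : 0 <= y by exact: mulr_ge0.
have var : (p * A + q * B) ^+ 2 = m - p * q * (A - B) ^+ 2.
  by rewrite /m -AE -BE; have -> : p = 1 - q by [lra]; ring.
have y1 : y <= 1.
  rewrite /y -[leRHS]mulr1; apply: ler_pM => //.
  by rewrite ler_pdivrMr// mul1r -subr_ge0 -var sqr_ge0.
have MlT : M <= m * (1 - x).
  rewrite -ler_sqr ?nnegrE ?mulr_ge0//; last lra.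
  rewrite HM' exprMn; apply: ler_wpM2l; first exact: ltW.
  have := sqr_ge0 x; nra.
have hM : M `^ (1 + eta) <= m `^ (1 + eta) * (1 - x).
  apply: (@le_trans _ _ ((m * (1 - x)) `^ (1 + eta))).
    by apply: ge0_ler_powR; rewrite ?nnegrE ?mulr_ge0//; lra.
  rewrite powRM//; last lra.
  rewrite ler_wpM2l ?powR_ge0//.
  have [->|nz] := eqVneq (1 - x) 0; first by rewrite powR0// gt_eqF.
  have x'0 : 0 < 1 - x by lra.
  by apply: ge1r_powR; [apply/andP; split; lra | rewrite lerDl].
have hell c : 0 <= c -> m `^ (1 + eta) * (c / m + eta * (2 * (c / m) - 2 * Num.sqrt (c / m))) <= c `^ (1 + eta).
  move=> c0; have -> : c `^ (1 + eta) = m `^ (1 + eta) * (c / m) `^ (1 + eta).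
    by rewrite -powRM ?divr_ge0// mulrC divfK.
  by rewrite ler_wpM2l ?powR_ge0// powR_ge_hellinger// divr_ge0.
have hS : m `^ (1 + eta) * (1 + y) <= p * a `^ (1 + eta) + q * b `^ (1 + eta).
  have ha := ler_wpM2l p0 (hell a a0).
  have hb := ler_wpM2l q0 (hell b b0).
  apply: le_trans (lerD ha hb).
  rewrite mulrCA [q * _]mulrCA -mulrDr ler_wpM2l ?powR_ge0//.
  rewrite !sqrtrM// -/A -/B sqrtrV//.
  set r := Num.sqrt m.
  have r0 : 0 < r by rewrite sqrtr_gt0.
  have rE : r ^+ 2 = m by rewrite sqr_sqrtr.
  have main : (p * A + q * B) / r <= 1 - p * q * (A - B) ^+ 2 / m / 2.
    set z := p * q * (A - B) ^+ 2 / m.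
    have z1 : z <= 1 by rewrite ler_pdivrMr// mul1r -subr_ge0 -var sqr_ge0.
    rewrite -ler_sqr ?nnegrE; [|by apply: divr_ge0; [rewrite addr_ge0 ?mulr_ge0|exact: ltW]|lra].
    rewrite expr_div_n var rE mulrBl divff// -/z; have := sqr_ge0 z; nra.
  have -> : p * (a / m + eta * (2 * (a / m) - 2 * (A / r))) +
    q * (b / m + eta * (2 * (b / m) - 2 * (B / r))) =
    1 + 2 * eta * (1 - (p * A + q * B) / r).
    transitivity (m / m + 2 * eta * (m / m - (p * A + q * B) / r)); last by rewrite divff.
    rewrite /m; ring.
  rewrite lerD2l /y.
  have := ler_wpM2l e0 main; lra.
apply: (le_trans hM).
have gain : eta * (p * q) * t / 8 <= x + y / 2.
  have := @two_point_gain p q A B (t / 2) p0 q0 pq A0 B0.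
  rewrite AE BE -/m => /(_ m0) g; have {g} := g ltac:(apply/andP; lra).
  move=> /(ler_wpM2l (mulr_ge0 e0 pq0)).
  rewrite mulrDr.
  set g1 := _ * (_ ^+ 2 / m).
  have -> : g1 = y by rewrite /g1 /y; field.
  have : eta * (p * q) * (t / 2 * (a * b) / m ^+ 2) <= x / 2.
    have -> : eta * (p * q) * (t / 2 * (a * b) / m ^+ 2) = eta * (x / 2).
      by rewrite /x; field.
    by rewrite ler_piMl// divr_ge0.
  by move=> ? ?; lra.
apply: (@le_trans _ _ (expR (- (x + y / 2)) * (m `^ (1 + eta) * (1 + y)))); last first.
  by apply: ler_pM; rewrite ?expR_ge0 ?mulr_ge0 ?powR_ge0 ?ler_expR ?lerN2//; lra.
rewrite mulrCA ler_wpM2l ?powR_ge0// opprD expRD.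
have ex : 1 - x <= expR (- x) by exact: expR_ge1Dx.
have ey : 1 - y / 2 <= expR (- (y / 2)) by exact: expR_ge1Dx.
apply: (@le_trans _ _ (expR (- x) * ((1 - y / 2) * (1 + y)))).
  rewrite -[leLHS]mulr1; apply: ler_pM => //; first lra.
  nra.
rewrite -[leRHS]mulrA; apply: ler_wpM2l; first exact: expR_ge0.
by apply: ler_wpM2r => //; lra.
Qed.

(** * Measures on the cube and their characteristic functions *)

Lemma sum_tupleS {V : nmodType} n (G : seq bool -> V) :
  \sum_(s : n.+1.-tuple bool) G s =
  \sum_(s : n.-tuple bool) (G (true :: s) + G (false :: s)).
Proof.
pose h (z : bool * n.-tuple bool) := [tuple of z.1 :: z.2].
pose h' (s : n.+1.-tuple bool) := (thead s, [tuple of behead s]).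
rewrite (reindex h) /=; last first.
  exists h' => [[b s] _|s _]; last by rewrite /h /h' /= -tuple_eta.
  by rewrite /h' /h /=; congr (_, _); apply: val_inj.
rewrite -(pair_bigA _ (fun b s => G (b :: tval s))) /=.
by rewrite big_bool -big_split.
Qed.

Lemma sum_tuple0 {V : nmodType} (G : seq bool -> V) :
  \sum_(s : 0.-tuple bool) G s = G [::].
Proof.
by rewrite (big_pred1 [tuple])// => s; apply/esym/eqP; exact: tuple0.
Qed.

(** A measure on the cube of dimension n is a nonnegative weight on bit
    sequences of length n; no normalization is imposed. *)
Definition mass n w := \sum_(s : n.-tuple bool) w s.

Definition branch w b := fun s : seq bool => w (b :: s).

Lemma massS n w : mass n.+1 w = mass n (branch w true) + mass n (branch w false).
Proof. by rewrite /mass sum_tupleS big_split. Qed.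

Lemma mass_ge0 n w : (forall s, 0 <= w s) -> 0 <= mass n w.
Proof. by move=> w0; exact: sumr_ge0. Qed.

Definition balanced (kappa a b : R) := (kappa * (a + b) <= a) && (kappa * (a + b) <= b).

(** Bit sequences are revealed from the first bit on: the test at a node compares the masses
    of its two subtrees. *)
Fixpoint prefix_mask kappa w (y : seq bool) : seq bool :=
  if y is b :: y' then
    balanced kappa (mass (size y') (branch w true)) (mass (size y') (branch w false))
      :: prefix_mask kappa (branch w b) y'
  else [::].

(** Bit sequences are revealed from the last bit on: the first bit is conditioned on all the
    others, and the recursion goes on with the marginal of the other bits. *)
Fixpoint suffix_mask kappa v (x : seq bool) : seq bool :=
  if x is c :: x' then
    balanced kappa (v (true :: x')) (v (false :: x'))
      :: suffix_mask kappa (fun s => v (true :: s) + v (false :: s)) x'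
  else [::].

(** The scalar product of phi with the vector of signs coded by y. *)
Fixpoint phase phi (y : seq bool) : R :=
  match phi, y with
  | f :: phi', b :: y' => (if b then f else - f) + phase phi' y'
  | _, _ => 0
  end.

Definition char_cos n phi w := \sum_(y : n.-tuple bool) w y * cos (phase phi y).
Definition char_sin n phi w := \sum_(y : n.-tuple bool) w y * sin (phase phi y).
Definition char_norm n phi w := Num.sqrt (char_cos n phi w ^+ 2 + char_sin n phi w ^+ 2).

Lemma char_cosS n f phi w : char_cos n.+1 (f :: phi) w =
  (cos f * char_cos n phi (branch w true) - sin f * char_sin n phi (branch w true)) +
  (cos f * char_cos n phi (branch w false) + sin f * char_sin n phi (branch w false)).
Proof.
rewrite /char_cos /char_sin (sum_tupleS _ (fun y => w y * cos (phase (f :: phi) y))) /=.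
rewrite !mulr_sumr -sumrB -!big_split/=.
by apply: eq_bigr => y _; rewrite !cosD cosN sinN /branch; ring.
Qed.

Lemma char_sinS n f phi w : char_sin n.+1 (f :: phi) w =
  (sin f * char_cos n phi (branch w true) + cos f * char_sin n phi (branch w true)) +
  (- sin f * char_cos n phi (branch w false) + cos f * char_sin n phi (branch w false)).
Proof.
rewrite /char_cos /char_sin (sum_tupleS _ (fun y => w y * sin (phase (f :: phi) y))) /=.
rewrite !mulr_sumr -!big_split/=.
by apply: eq_bigr => y _; rewrite !sinD cosN sinN /branch; ring.
Qed.

Definition dir_cos n phi w :=
  if char_norm n phi w == 0 then 1 else char_cos n phi w / char_norm n phi w.
Definition dir_sin n phi w :=
  if char_norm n phi w == 0 then 0 else char_sin n phi w / char_norm n phi w.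

Lemma char_norm_sqr n phi w : char_norm n phi w ^+ 2 = char_cos n phi w ^+ 2 + char_sin n phi w ^+ 2.
Proof. by rewrite sqr_sqrtr// addr_ge0 ?sqr_ge0. Qed.

Lemma char_norm_ge0 n phi w : 0 <= char_norm n phi w.
Proof. exact: sqrtr_ge0. Qed.

Lemma char_cos_dir n phi w : char_cos n phi w = char_norm n phi w * dir_cos n phi w.
Proof.
rewrite /dir_cos; case: eqVneq => [N0|N0]; last by rewrite mulrCA divff ?mulr1.
have := char_norm_sqr n phi w; rewrite N0 expr0n/= mul0r => /esym/eqP.
by rewrite paddr_eq0 ?sqr_ge0// !sqrf_eq0 => /andP[/eqP->].
Qed.

Lemma char_sin_dir n phi w : char_sin n phi w = char_norm n phi w * dir_sin n phi w.
Proof.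
rewrite /dir_sin; case: eqVneq => [N0|N0]; last by rewrite mulrCA divff ?mulr1.
have := char_norm_sqr n phi w; rewrite N0 expr0n/= mul0r => /esym/eqP.
by rewrite paddr_eq0 ?sqr_ge0// !sqrf_eq0 => /andP[_ /eqP->].
Qed.

Lemma dir_unit n phi w : dir_cos n phi w ^+ 2 + dir_sin n phi w ^+ 2 = 1.
Proof.
rewrite /dir_cos /dir_sin; case: eqVneq => [_|N0]; first by rewrite expr1n expr0n/= addr0.
by rewrite !expr_div_n -mulrDl -char_norm_sqr divff// sqrf_eq0.
Qed.

(** One minus the real part of z1 (conj z0) e^(2if), where z1 and z0 are the
    directions of the characteristic functions of the two branches: the amount by
    which the first sign of phase f fails to align them.  The direction of 0 is
    set to 1, so that directions are always unit vectors. *)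
Definition turn n phi (f : R) w :=
  let c1 := dir_cos n phi (branch w true) in let s1 := dir_sin n phi (branch w true) in
  let c0 := dir_cos n phi (branch w false) in let s0 := dir_sin n phi (branch w false) in
  1 - ((c1 * c0 + s1 * s0) * cos (2 * f) - (s1 * c0 - c1 * s0) * sin (2 * f)).

Lemma turn_bound n phi f w : 0 <= turn n phi f w <= 2.
Proof.
rewrite /turn /=.
have := dir_unit n phi (branch w true); have := dir_unit n phi (branch w false).
move: (dir_cos _ _ _) (dir_sin _ _ _) (dir_cos _ _ _) (dir_sin _ _ _) => c1 s1 c0 s0 h0 h1.
have h2 := cos2Dsin2 (2 * f); move: (cos _) (sin _) h2 => c s h2.
set u := c1 * c0 + s1 * s0; set z := s1 * c0 - c1 * s0.
have h3 : u ^+ 2 + z ^+ 2 = 1.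
  have -> : u ^+ 2 + z ^+ 2 = (c1 ^+ 2 + s1 ^+ 2) * (c0 ^+ 2 + s0 ^+ 2).
    by rewrite /u /z; ring.
  by rewrite h0 h1 mulr1.
have := sqr_ge0 (u - c); have := sqr_ge0 (z + s).
have := sqr_ge0 (u + c); have := sqr_ge0 (z - s).
by clearbody u z; move=> *; apply/andP; split; lra.
Qed.

(** With unit vectors z, e, e', the parallelogram law gives
    |e - e'|^2 <= 2 |e - z|^2 + 2 |e' - z|^2: the two phases of a coordinate
    cannot both align the branches. *)
Lemma turn_add n phi f f' w :
  (1 - cos (2 * (f - f'))) / 2 <= turn n phi f w + turn n phi f' w.
Proof.
rewrite /turn /= mulrBr cosB.
have := dir_unit n phi (branch w true); have := dir_unit n phi (branch w false).
move: (dir_cos _ _ _) (dir_sin _ _ _) (dir_cos _ _ _) (dir_sin _ _ _) => c1 s1 c0 s0 h0 h1.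
have h2 := cos2Dsin2 (2 * f); move: (cos _) (sin _) h2 => c s h2.
have h2' := cos2Dsin2 (2 * f'); move: (cos _) (sin _) h2' => c' s' h2'.
set u := c1 * c0 + s1 * s0; set z := s1 * c0 - c1 * s0.
have h3 : u ^+ 2 + z ^+ 2 = 1.
  have -> : u ^+ 2 + z ^+ 2 = (c1 ^+ 2 + s1 ^+ 2) * (c0 ^+ 2 + s0 ^+ 2).
    by rewrite /u /z; ring.
  by rewrite h0 h1 mulr1.
have := sqr_ge0 (c + c' - 2 * u); have := sqr_ge0 (s + s' + 2 * z).
by clearbody u z; move=> *; lra.
Qed.

Lemma char_norm_split n f phi w : char_norm n.+1 (f :: phi) w ^+ 2 =
  (char_norm n phi (branch w true) + char_norm n phi (branch w false)) ^+ 2 -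
  2 * (char_norm n phi (branch w true) * char_norm n phi (branch w false)) * turn n phi f w.
Proof.
rewrite char_norm_sqr char_cosS char_sinS /turn /= !char_cos_dir !char_sin_dir.
have := dir_unit n phi (branch w true); have := dir_unit n phi (branch w false).
move: (dir_cos _ _ _) (dir_sin _ _ _) (dir_cos _ _ _) (dir_sin _ _ _) => c1 s1 c0 s0 h0 h1.
have -> : 2 * f = f + f by ring.
rewrite cosD sinD.
move: (char_norm _ _ _) (char_norm _ _ _) => b a.
have := cos2Dsin2 f; move: (cos _) (sin _) => c s h.
transitivity ((c ^+ 2 + s ^+ 2) * ((c1 ^+ 2 + s1 ^+ 2) * a ^+ 2 +
  (c0 ^+ 2 + s0 ^+ 2) * b ^+ 2) + 2 * (a * b) * ((c1 * c0 + s1 * s0) *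
  (c * c - s * s) - (s1 * c0 - c1 * s0) * (s * c + c * s))); first by ring.
by rewrite h h0 h1; ring.
Qed.

Lemma char_norm_le_mass n phi w : (forall s, 0 <= w s) -> size phi = n ->
  char_norm n phi w <= mass n w.
Proof.
elim: n phi w => [|n IH] [|f phi]// w w0.
  rewrite /char_norm /char_cos /char_sin /mass.
  rewrite (sum_tuple0 w) (sum_tuple0 (fun y => w y * cos (phase [::] y))).
  rewrite (sum_tuple0 (fun y => w y * sin (phase [::] y))) /= cos0 sin0 mulr0 mulr1.
  by rewrite expr0n/= addr0 sqrtr_sqr ger0_norm.
move=> [sz]; rewrite massS.
have m1 := IH phi (branch w true) (fun s => w0 _) sz.
have m0 := IH phi (branch w false) (fun s => w0 _) sz.
apply: (le_trans _ (lerD m1 m0)).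
rewrite -ler_sqr ?nnegrE ?addr_ge0 ?char_norm_ge0// char_norm_split lerBlDr lerDl.
have /andP[t0 _] := turn_bound n phi f w.
by rewrite !mulr_ge0// char_norm_ge0.
Qed.

(** * Decay of the characteristic function along the tree of B *)

(** The misalignments met along the path of y, counted at the balanced nodes. *)
Fixpoint loss kappa phi w (y : seq bool) : R :=
  match phi, y with
  | f :: phi', b :: y' =>
    (balanced kappa (mass (size y') (branch w true)) (mass (size y') (branch w false)))%:R
      * turn (size y') phi' f w + loss kappa phi' (branch w b) y'
  | _, _ => 0
  end.

(** Induction on the tree, with [two_point] at each node.  The power 1 + eta, rather than 2,
    makes it possible to bound the modulus itself without losing a square root. *)
Lemma char_norm_powR_le n kappa eta phi w : (forall s, 0 <= w s) -> size phi = n ->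
  0 <= kappa <= 1 / 2 -> 0 <= eta <= 1 ->
  mass n w * (char_norm n phi w / mass n w) `^ (1 + eta) <=
  \sum_(y : n.-tuple bool)
    w y * expR (- (kappa / 16 * eta * loss kappa phi w y)).
Proof.
move=> + + /andP[k0 k1] /andP[e0 e1].
elim: n phi w => [|n IH] [|f phi]// w w0.
  move=> _; rewrite /mass sum_tuple0.
  rewrite (sum_tuple0 (fun y => w y * expR (- (kappa / 16 * eta * loss kappa [::] w y)))) /=.
  rewrite mulr0 oppr0 expR0 mulr1.
  rewrite ler_piMr//.
  apply: (@le_trans _ _ (1 `^ (1 + eta))); last by rewrite powR1.
  rewrite ge0_ler_powR ?nnegrE ?addr_ge0//.
  - by rewrite divr_ge0 ?char_norm_ge0.
  - have := char_norm_le_mass 0 [::] w w0 erefl; rewrite /mass sum_tuple0.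
    have [->|n0] := eqVneq (w [::]) 0; first by rewrite invr0 mulr0.
    by rewrite ler_pdivrMr ?mul1r// lt_def n0 w0.
move=> [sz].
set m := mass n.+1 w; set m1 := mass n (branch w true); set m0 := mass n (branch w false).
have w1 s : 0 <= branch w true s by exact: w0.
have w0' s : 0 <= branch w false s by exact: w0.
have m1_ge0 : 0 <= m1 by exact: mass_ge0.
have m0_ge0 : 0 <= m0 by exact: mass_ge0.
have mE : m = m1 + m0 by exact: massS.
have [m_eq0|m_neq0] := eqVneq m 0.
  by rewrite m_eq0 mul0r; apply: sumr_ge0 => y _; rewrite mulr_ge0 ?expR_ge0.
have m_gt0 : 0 < m by rewrite lt_def m_neq0 mE addr_ge0.
set N1 := char_norm n phi (branch w true); set N0 := char_norm n phi (branch w false).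
have N1E : m1 * (N1 / m1) = N1.
  have [z|nz] := eqVneq m1 0; last by rewrite mulrCA divff ?mulr1.
  rewrite z mul0r; apply/eqP; rewrite eq_le char_norm_ge0 andTb -[leRHS]z; exact: char_norm_le_mass.
have N0E : m0 * (N0 / m0) = N0.
  have [z|nz] := eqVneq m0 0; last by rewrite mulrCA divff ?mulr1.
  rewrite z mul0r; apply/eqP; rewrite eq_le char_norm_ge0 andTb -[leRHS]z; exact: char_norm_le_mass.
have tb := turn_bound n phi f w.
set t := turn n phi f w in tb.
have tp := @two_point (m1 / m) (m0 / m) (N1 / m1) (N0 / m0)
  (char_norm n.+1 (f :: phi) w / m) t eta.
have {}tp := tp (divr_ge0 m1_ge0 (ltW m_gt0)) (divr_ge0 m0_ge0 (ltW m_gt0)).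
have {}tp := tp ltac:(by rewrite -mulrDl -mE divff)
  (divr_ge0 (char_norm_ge0 _ _ _) m1_ge0) (divr_ge0 (char_norm_ge0 _ _ _) m0_ge0)
  (divr_ge0 (char_norm_ge0 _ _ _) (ltW m_gt0)) tb ltac:(by rewrite e0 e1).
have {}tp := ler_wpM2l (ltW m_gt0) (tp _).
apply: le_trans (tp _) _.
  rewrite expr_div_n char_norm_split -/N1 -/N0 -/t -{1 2}N1E -{1 2}N0E.
  by move: (N1 / m1) (N0 / m0) => z1 z0; field.
move: {tp} (IH phi _ w1 sz) (IH phi _ w0' sz); rewrite -/m1 -/m0 -/N1 -/N0.
set H1 := (N1 / m1) `^ _; set H0 := (N0 / m0) `^ _ => IH1 IH0.
have -> : m * (expR (- (eta * (m1 / m * (m0 / m)) * t / 8)) *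
    (m1 / m * H1 + m0 / m * H0)) =
  expR (- (eta * (m1 / m * (m0 / m)) * t / 8)) * (m1 * H1 + m0 * H0) by field.
rewrite (sum_tupleS _ (fun y => w y * expR (- (kappa / 16 * eta * loss kappa (f :: phi) w y)))).
rewrite big_split/=.
pose b : R := (balanced kappa m1 m0)%:R.
have bE (y : n.-tuple bool) :
  (balanced kappa (mass (size y) (branch w true)) (mass (size y) (branch w false)))%:R
    * turn (size y) phi f w = b * t by rewrite size_tuple.
have eE z c : w (c :: z) * expR (- (kappa / 16 * eta * (b * t + loss kappa phi (branch w c) z))) =
  expR (- (kappa / 16 * eta * (b * t))) * (branch w c z *
     expR (- (kappa / 16 * eta * loss kappa phi (branch w c) z))).
  by rewrite mulrDr opprD expRD mulrCA.
under eq_bigr do rewrite bE eE.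
under [X in _ <= _ + X]eq_bigr do rewrite bE eE.
rewrite -!mulr_sumr -mulrDr.
have H1_ge0 : 0 <= H1 by exact: powR_ge0.
have H0_ge0 : 0 <= H0 by exact: powR_ge0.
apply: ler_pM; [exact: expR_ge0 | by rewrite addr_ge0 ?mulr_ge0 | | exact: lerD].
have /andP[t0 t2] := tb.
rewrite ler_expR lerN2 /b; case: (boolP (balanced kappa m1 m0)) => [/andP[b1 b2]|_] /=; last first.
  rewrite mul0r mulr0; apply: divr_ge0 => //; apply: mulr_ge0 => //.
  by apply: mulr_ge0 => //; apply: mulr_ge0; exact: divr_ge0 (ltW m_gt0).
rewrite mul1r.
have q1 : kappa <= m1 / m by rewrite ler_pdivlMr// mE.
have q0 : kappa <= m0 / m by rewrite ler_pdivlMr// mE.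
have qq : m1 / m + m0 / m = 1 by rewrite -mulrDl -mE divff.
have : kappa / 2 <= m1 / m * (m0 / m) by move: (m1 / m) (m0 / m) q1 q0 qq => P Q; nra.
move=> /(ler_wpM2l e0) /(ler_wpM2r t0); lra.
Qed.

(** * Averaging over the direction *)

Definition meet_mask (m m' : seq bool) := [seq z.1 && z.2 | z <- zip m m'].
Definition mask_sum (m : seq bool) (g : seq R) : R :=
  \sum_(z <- zip m g) z.1%:R * z.2.
Definition angles (p : seq (R * R)) (x : seq bool) : seq R :=
  [seq if z.2 then z.1.1 else z.1.2 | z <- zip p x].
Definition gaps (p : seq (R * R)) : seq R := [seq 1 - cos (2 * (q.1 - q.2)) | q <- p].

(** A balanced bit puts weight at least kappa on the larger of t1 and t0. *)
Lemma balanced_decay (kappa a1 a0 t1 t0 g : R) : 0 <= kappa ->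
  0 <= a1 -> 0 <= a0 -> 0 <= t1 <= 2 -> 0 <= t0 <= 2 -> g / 2 <= t1 + t0 ->
  balanced kappa a1 a0 ->
  a1 * expR (- t1) + a0 * expR (- t0) <= (a1 + a0) * expR (- (kappa / 6 * g)).
Proof.
move=> k0 a10 a00 t1b t0b gt /andP[b1 b0].
have h1 := ler_wpM2l a10 (expRN_le _ t1b).
have h0 := ler_wpM2l a00 (expRN_le _ t0b).
move: t1b t0b => /andP[t10 _] /andP[t00 _].
apply: (@le_trans _ _ ((a1 + a0) * (1 - kappa / 6 * g))); last first.
  by apply: ler_wpM2l; [rewrite addr_ge0 | exact: expR_ge1Dx].
apply: (le_trans (lerD h1 h0)).
have e1 := ler_wpM2r t10 b1.
have e0 := ler_wpM2r t00 b0.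
have e2 := ler_wpM2l (mulr_ge0 k0 (addr_ge0 a10 a00)) gt.
nra.
Qed.

(** For fixed y, the exponential of the compensator minus the loss is a
    supermartingale when the bits of x are revealed from the last one on: the
    node of y at coordinate j sees x only through the bits from j on, so that
    summing over the first bit leaves the same statement in dimension n - 1. *)
Lemma suffix_compensator n kappa p v w y : 0 <= kappa -> (forall s, 0 <= v s) ->
  size p = n -> size y = n ->
  \sum_(x : n.-tuple bool) v x *
    expR (kappa / 6 * mask_sum (meet_mask (suffix_mask kappa v x) (prefix_mask kappa w y)) (gaps p)
          - loss kappa (angles p x) w y) <= mass n v.
Proof.
move=> k0; elim: n p v w y => [|n IH] [|q p] v w [|b y]// v0.
  move=> _ _; rewrite /mass sum_tuple0.
  rewrite (sum_tuple0 (fun x => v x * expR (kappa / 6 * mask_sum (meet_mask (suffix_mask kappa v x) (prefix_mask kappa w [::])) (gaps [::])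
          - loss kappa (angles [::] x) w [::]))) /=.
  by rewrite /mask_sum /= big_nil mulr0 subr0 expR0 mulr1.
move=> [szp] [szy].
set v' := fun s => v (true :: s) + v (false :: s).
have -> : mass n.+1 v = mass n v' by rewrite /mass sum_tupleS.
have v'0 s : 0 <= v' s by rewrite addr_ge0.
apply: le_trans (IH p v' (branch w b) y v'0 szp szy).
rewrite (sum_tupleS _ (fun x => v x * expR (kappa / 6 * mask_sum (meet_mask (suffix_mask kappa v x) (prefix_mask kappa w (b :: y))) (gaps (q :: p))
          - loss kappa (angles (q :: p) x) w (b :: y)))) /=.
apply: ler_sum => s _.
rewrite /mask_sum /= !big_cons /= -/(mask_sum _ _) -/v'.
rewrite -/(angles p s) -/(gaps p) -/(meet_mask _ _).
set rest := mask_sum _ _.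
set l := loss kappa (angles p s) _ y.
set B := balanced kappa (mass _ _) _.
have mv (a g t : R) : a * expR (kappa / 6 * (g + rest) - (t + l)) =
   a * expR (kappa / 6 * g - t) * expR (kappa / 6 * rest - l).
  by rewrite -[RHS]mulrA -expRD; congr (_ * expR _); ring.
rewrite (mv (v (true :: s))) (mv (v (false :: s))) -mulrDl.
apply: ler_wpM2r; first exact: expR_ge0.
have t1b := turn_bound (size y) (angles p s) q.1 w.
have t0b := turn_bound (size y) (angles p s) q.2 w.
have tt := turn_add (size y) (angles p s) q.1 q.2 w.
move: (turn _ _ q.1 _) (turn _ _ q.2 _) t1b t0b tt => t1 t0 t1b t0b tt.
case: B; rewrite ?andbT ?andbF ?mul0r ?mulr0 ?subr0 ?expR0 ?mulr1//=.
rewrite !mul1r.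
case: (boolP (balanced kappa _ _)) => [bal|_] /=.
  rewrite mul1r !expRD mulrCA [X in _ + X <= _]mulrCA -mulrDr.
  rewrite -ler_pdivlMl ?expR_gt0// [leRHS]mulrC -expRN.
  exact: balanced_decay.
rewrite mul0r mulr0 !sub0r /v'; apply: lerD; rewrite ler_piMr// expR_le1 oppr_le0.
  by case/andP: t1b.
by case/andP: t0b.
Qed.

(** * Most pairs have many common balanced coordinates *)

(** If the pair is balanced, both powers are at most the power of the sum; if
    not, one of the two is at most kappa^eps times it. *)
Lemma balanced_powR_sum (kappa eps a b : R) : 0 <= a -> 0 <= b -> 0 <= kappa ->
  0 < eps <= 1 ->
  (1 / 2) ^+ balanced kappa a b * (a `^ eps + b `^ eps) <=
    (a + b) `^ eps * (1 + kappa `^ eps).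
Proof.
move=> a0 b0 k0 /andP[e0 e1].
have ab0 : 0 <= a + b by rewrite addr_ge0.
have ha : a `^ eps <= (a + b) `^ eps.
  by rewrite ge0_ler_powR ?nnegrE ?lerDl// ltW.
have hb : b `^ eps <= (a + b) `^ eps.
  by rewrite ge0_ler_powR ?nnegrE ?lerDr// ltW.
have kp : 0 <= kappa `^ eps by exact: powR_ge0.
have sp : 0 <= (a + b) `^ eps by exact: powR_ge0.
have skp := mulr_ge0 sp kp.
rewrite [_ * (1 + _)]mulrDr mulr1.
case: (boolP (balanced _ _ _)) => [_|]; first by rewrite expr1; lra.
rewrite expr0 mul1r negb_and -!ltNge => /orP[h|h].
  have : a `^ eps <= (a + b) `^ eps * kappa `^ eps.
    rewrite -powRM// mulrC; apply: ge0_ler_powR; rewrite ?nnegrE ?mulr_ge0//; exact: ltW.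
  by lra.
have : b `^ eps <= (a + b) `^ eps * kappa `^ eps.
  rewrite -powRM// mulrC; apply: ge0_ler_powR; rewrite ?nnegrE ?mulr_ge0//; exact: ltW.
by lra.
Qed.

(** An entropy estimate: for the indicator of a set of size 2^(beta n), it says
    that few elements have many fewer than beta n balanced coordinates. *)
Lemma prefix_mask_sum n kappa eps w : 0 <= kappa -> 0 < eps <= 1 ->
  (forall s, 0 <= w s) ->
  \sum_(y : n.-tuple bool) (1 / 2) ^+ count id (prefix_mask kappa w y) * w y `^ eps <=
    mass n w `^ eps * (1 + kappa `^ eps) ^+ n.
Proof.
move=> k0 eb; elim: n w => [|n IH] w w0.
  rewrite (sum_tuple0 (fun y => (1 / 2) ^+ count id (prefix_mask kappa w y) * w y `^ eps)).
  by rewrite /mass sum_tuple0 /= !expr0 mulr1 mul1r.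
rewrite (sum_tupleS _ (fun y => (1 / 2) ^+ count id (prefix_mask kappa w y) * w y `^ eps)) /=.
set m1 := mass n (branch w true); set m0 := mass n (branch w false).
have balE (y : n.-tuple bool) : balanced kappa (mass (size y) (branch w true)) (mass (size y) (branch w false)) = balanced kappa m1 m0.
  by rewrite size_tuple.
under eq_bigr do rewrite !balE !exprD -!mulrA.
rewrite big_split/= -!mulr_sumr -mulrDr.
have kp : 0 <= 1 + kappa `^ eps by rewrite addr_ge0 ?powR_ge0.
have m1_ge0 : 0 <= m1 by apply: mass_ge0 => s; exact: w0.
have m0_ge0 : 0 <= m0 by apply: mass_ge0 => s; exact: w0.
rewrite massS exprS mulrA.
have i1 := IH _ (fun s => w0 (true :: s) : 0 <= branch w true s).
have i0 := IH _ (fun s => w0 (false :: s) : 0 <= branch w false s).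
apply: le_trans (ler_wpM2r (exprn_ge0 n kp) (balanced_powR_sum kappa eps m1 m0 m1_ge0 m0_ge0 k0 eb)).
rewrite -mulrA mulrDl; apply: ler_wpM2l; last exact: lerD.
by rewrite exprn_ge0.
Qed.

Lemma suffix_mask_sum n kappa eps v : 0 <= kappa -> 0 < eps <= 1 ->
  (forall s, 0 <= v s) ->
  \sum_(x : n.-tuple bool) (1 / 2) ^+ count id (suffix_mask kappa v x) * v x `^ eps <=
    mass n v `^ eps * (1 + kappa `^ eps) ^+ n.
Proof.
move=> k0 eb; elim: n v => [|n IH] v v0.
  rewrite (sum_tuple0 (fun y => (1 / 2) ^+ count id (suffix_mask kappa v y) * v y `^ eps)).
  by rewrite /mass sum_tuple0 /= !expr0 mulr1 mul1r.
rewrite (sum_tupleS _ (fun y => (1 / 2) ^+ count id (suffix_mask kappa v y) * v y `^ eps)) /=.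
set v' := fun s => v (true :: s) + v (false :: s).
have -> : mass n.+1 v = mass n v' by rewrite /mass sum_tupleS.
have v'0 s : 0 <= v' s by rewrite addr_ge0.
have kp : 0 <= 1 + kappa `^ eps by rewrite addr_ge0 ?powR_ge0.
rewrite exprS mulrCA.
apply: le_trans (ler_wpM2l kp (IH v' v'0)).
rewrite mulr_sumr; apply: ler_sum => s _.
rewrite -mulrDr exprD -mulrA mulrCA [leRHS]mulrCA; apply: ler_wpM2l.
  by rewrite exprn_ge0.
rewrite [leRHS]mulrC; exact: balanced_powR_sum.
Qed.

Lemma count_meet (m m' : seq bool) : size m = size m' ->
  (count id m + count id m' <= size m + count id (meet_mask m m'))%N.
Proof.
elim: m m' => [|a m IH] [|b m']// [/IH]; rewrite /meet_mask /=.
case: a; case: b => /=; lia.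
Qed.

Lemma size_prefix_mask kappa w y : size (prefix_mask kappa w y) = size y.
Proof. by elim: y w => //= b y IH w; rewrite IH. Qed.

Lemma size_suffix_mask kappa v x : size (suffix_mask kappa v x) = size x.
Proof. by elim: x v => //= b x IH v; rewrite IH. Qed.

(** If fewer than kappa n coordinates are balanced for both, then the numbers of
    balanced coordinates of x and y add up to at most (1 + kappa) n, and the
    weights 2^(-count) of [prefix_mask_sum] and [suffix_mask_sum] apply. *)
Lemma few_common_balanced n (kappa eps : R) v w : 0 <= kappa -> 0 < eps <= 1 ->
  (forall s, v s = 0 \/ v s = 1) -> (forall s, w s = 0 \/ w s = 1) ->
  \sum_(x : n.-tuple bool) \sum_(y : n.-tuple bool) v x * w y *
     ((count id (meet_mask (suffix_mask kappa v x) (prefix_mask kappa w y)))%:R < kappa * n%:R)%R%:R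
  <= 2 `^ (n%:R * (1 + kappa)) * ((mass n v * mass n w) `^ eps * ((1 + kappa `^ eps) ^+ n) ^+ 2).
Proof.
move=> k0 eb v01 w01.
have /andP[e0 e1] := eb.
have v0 s : 0 <= v s by case: (v01 s) => ->.
have w0 s : 0 <= w s by case: (w01 s) => ->.
have ve s : v s `^ eps = v s by case: (v01 s) => ->; rewrite ?powR1// powR0// gt_eqF.
have we s : w s `^ eps = w s by case: (w01 s) => ->; rewrite ?powR1// powR0// gt_eqF.
have := ler_pM _ _ (suffix_mask_sum n kappa eps v k0 eb v0) (prefix_mask_sum n kappa eps w k0 eb w0).
move=> /(_ _)/(_ _) h.
have {}h := h ltac:(by apply: sumr_ge0 => s _; rewrite mulr_ge0 ?exprn_ge0 ?powR_ge0)
  ltac:(by apply: sumr_ge0 => s _; rewrite mulr_ge0 ?exprn_ge0 ?powR_ge0).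
have -> : (mass n v * mass n w) `^ eps * ((1 + kappa `^ eps) ^+ n) ^+ 2 =
    (mass n v `^ eps * (1 + kappa `^ eps) ^+ n) *
    (mass n w `^ eps * (1 + kappa `^ eps) ^+ n).
  rewrite powRM; [by ring | exact: mass_ge0 | exact: mass_ge0].
apply: le_trans (ler_wpM2l (powR_ge0 _ _) h).
rewrite mulr_suml mulr_sumr; apply: ler_sum => x _.
rewrite !mulr_sumr; apply: ler_sum => y _.
rewrite ve we.
case: ltP => [lt|_]; last first.
  by rewrite mulr0 mulr_ge0 ?powR_ge0 ?mulr_ge0 ?exprn_ge0.
rewrite mulr1.
set a := count id (suffix_mask _ _ _); set b := count id (prefix_mask _ _ _).
have cab : (a + b <= n + count id (meet_mask (suffix_mask kappa v x) (prefix_mask kappa w y)))%N.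
  rewrite /a /b; apply: leq_trans (count_meet _ _ _) _.
    by rewrite size_suffix_mask size_prefix_mask !size_tuple.
  by rewrite size_suffix_mask size_tuple.
have -> : 2 `^ (n%:R * (1 + kappa)) * ((1 / 2) ^+ a * v x * ((1 / 2) ^+ b * w y)) =
  v x * w y * (2 `^ (n%:R * (1 + kappa)) * (1 / 2) ^+ (a + b)) by rewrite exprD; ring.
rewrite ler_peMr ?mulr_ge0// div1r exprVn -powR_mulrn//.
rewrite ler_pdivlMr ?powR_gt0// mul1r; apply: ler_powR; first lra.
move: cab; rewrite -(ler_nat R) !natrD => cab; lra.
Qed.

Lemma loss_ge0 kappa phi w y : 0 <= loss kappa phi w y.
Proof.
elim: phi w y => [|f phi IH] w [|b y]//=.
rewrite addr_ge0// mulr_ge0//.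
by have /andP[] := turn_bound (size y) phi f w.
Qed.

(** * Average decay at one frequency *)

(** Combines [char_norm_powR_le] and [suffix_compensator] with eta = 1 / T.  The
    two truncations at exp (-2 T) cost only constants, since
    exp (2 T eta) = e^2. *)
Lemma char_norm_average_le n kappa T p v w :
  0 <= kappa <= 1 / 2 -> 1 <= T -> size p = n ->
  (forall s, 0 <= v s) -> (forall s, 0 <= w s) ->
  \sum_(x : n.-tuple bool) v x * char_norm n (angles p x) w <=
  expR 3 * (mass n v * mass n w * expR (- (2 * T)) +
   \sum_(x : n.-tuple bool) \sum_(y : n.-tuple bool) v x * w y *
     expR (- (kappa ^+ 2 / (96 * T) *
        mask_sum (meet_mask (suffix_mask kappa v x) (prefix_mask kappa w y)) (gaps p)))).
Proof.
move=> /andP[k0 k1] T1 szp v0 w0.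
have T0 : 0 < T by lra.
set m := mass n w; set V := mass n v.
have m0 : 0 <= m by exact: mass_ge0.
have V0 : 0 <= V by exact: mass_ge0.
pose eta := T^-1.
have eb : 0 <= eta <= 1 by rewrite invr_ge0 ltW//= invf_le1.
have /andP[e0 e1] := eb.
have eT : eta * T = 1 by rewrite mulVf ?gt_eqF.
pose S x y := loss kappa (angles p x) w y.
pose Q x y := mask_sum (meet_mask (suffix_mask kappa v x) (prefix_mask kappa w y)) (gaps p).
have E2 : 1 + 2 <= expR 2 :> R by exact: expR_ge1Dx.
have E1 : 1 + 1 <= expR 1 :> R by exact: expR_ge1Dx.
have E3 : expR 3 = expR 1 * expR 2 :> R by rewrite -expRD; congr expR; lra.
(* Moduli below the truncation level are absorbed in the first term; above it the
   power eta of the normalized modulus is at least exp (-2). *)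
have stepx x : size x = n -> char_norm n (angles p x) w <= m * expR (- (2 * T)) +
    expR 2 * \sum_(y : n.-tuple bool) w y * expR (- (kappa / 16 * eta * S x y)).
  move=> szx.
  have szphi : size (angles p x) = n by rewrite size_map size_zip szp szx minnn.
  have mh : 0 <= m * expR (- (2 * T)) by rewrite mulr_ge0 ?expR_ge0.
  have sh : 0 <= \sum_(y : n.-tuple bool) w y * expR (- (kappa / 16 * eta * S x y)).
    by apply: sumr_ge0 => y _; rewrite mulr_ge0 ?expR_ge0.
  have [small|big] := leP (char_norm n (angles p x) w) (m * expR (- (2 * T))).
    by rewrite (le_trans small)// lerDl mulr_ge0 ?expR_ge0.
  have mgt : 0 < m.
    rewrite lt_def m0 andbT; apply/eqP => mz.
    have := char_norm_le_mass n (angles p x) w w0 szphi; rewrite -/m mz.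
    by move: big; rewrite mz mul0r => /lt_le_trans h /h; rewrite ltxx.
  apply: (@le_trans _ _ (expR 2 * (m * (char_norm n (angles p x) w / m) `^ (1 + eta)))).
    set F := char_norm _ _ _ in big *.
    have F0 : 0 < F by apply: le_lt_trans big.
    set f := F / m.
    have f0 : 0 < f by rewrite divr_gt0.
    have -> : F = m * f by rewrite mulrCA divff ?mulr1// gt_eqF.
    rewrite [leRHS]mulrCA; apply: ler_wpM2l => //.
    rewrite powRD ?(gt_eqF f0) ?implybT// powRr1 ?(ltW f0)// [leRHS]mulrCA ler_peMr ?(ltW f0)//.
    rewrite /powR (gt_eqF f0) -expRD -[X in X <= _]expR0 ler_expR.
    have lf : - (2 * T) <= ln f.
      by rewrite -[leLHS]expRK ler_ln ?posrE ?expR_gt0// ler_pdivlMr// mulrC ltW.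
    have e2 : eta * - (2 * T) = - 2 by rewrite mulrN mulrCA eT mulr1.
    have := ler_wpM2l e0 lf; rewrite e2; lra.
  apply: (@le_trans _ _ (expR 2 * \sum_(y : n.-tuple bool) w y * expR (- (kappa / 16 * eta * S x y)))).
    apply: ler_wpM2l; first exact: expR_ge0.
    by apply: char_norm_powR_le => //; rewrite k0.
  by rewrite lerDr.
(* Either the loss is at least the compensator up to 2 T, or the second term, whose
   mean [suffix_compensator] controls, exceeds 1. *)
have stepQ (x y : seq bool) : expR (- (kappa / 16 * eta * S x y)) <=
  expR 1 * expR (- (kappa ^+ 2 / (96 * T) * Q x y)) +
  expR (- (2 * T)) * expR (kappa / 6 * Q x y - S x y).
  have c0 : 0 <= kappa / 16 * eta by rewrite mulr_ge0// divr_ge0.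
  have [big|small] := leP (kappa / 6 * Q x y - 2 * T) (S x y).
    apply: (@le_trans _ _ (expR 1 * expR (- (kappa ^+ 2 / (96 * T) * Q x y)))); last first.
      by rewrite lerDl mulr_ge0 ?expR_ge0.
    rewrite -expRD ler_expR.
    have -> : kappa ^+ 2 / (96 * T) = kappa / 16 * eta * (kappa / 6).
      by rewrite /eta; field; exact: lt0r_neq0.
    have := ler_wpM2l c0 big.
    rewrite mulrBr mulrA.
    have -> : kappa / 16 * eta * (2 * T) = kappa / 8 * (eta * T) by field.
    rewrite eT; lra.
  apply: (@le_trans _ _ 1).
    by rewrite expR_le1 oppr_le0 mulr_ge0// loss_ge0.
  rewrite -[leLHS]add0r; apply: lerD; first by rewrite mulr_ge0 ?expR_ge0.
  rewrite -expRD -[X in X <= _]expR0 ler_expR; lra.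
pose G x := \sum_(y : n.-tuple bool) w y * expR (- (kappa ^+ 2 / (96 * T) * Q x y)).
pose H x := \sum_(y : n.-tuple bool) w y * expR (kappa / 6 * Q x y - S x y).
have stepG x : size x = n -> char_norm n (angles p x) w <=
    m * expR (- (2 * T)) + expR 3 * G x + expR 2 * expR (- (2 * T)) * H x.
  move=> szx; apply: (le_trans (stepx x szx)).
  rewrite -addrA lerD2l E3 [expR 1 * _]mulrC -[expR 2 * expR 1 * _]mulrA -[expR 2 * expR (- _) * _]mulrA -mulrDr; apply: ler_wpM2l.
    exact: expR_ge0.
  rewrite !mulr_sumr -big_split/=; apply: ler_sum => y _.
  have := ler_wpM2l (w0 y) (stepQ x y); lra.
have HV : \sum_(x : n.-tuple bool) v x * H x <= m * V.
  rewrite /H; under eq_bigr do rewrite mulr_sumr.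
  rewrite exchange_big/= /m /mass mulr_suml; apply: ler_sum => y _.
  under eq_bigr do rewrite mulrCA.
  rewrite -mulr_sumr; apply: ler_wpM2l => //.
  by apply: suffix_compensator => //; rewrite size_tuple.
apply: (@le_trans _ _ (\sum_(x : n.-tuple bool) (v x * (m * expR (- (2 * T))) +
    expR 3 * (v x * G x) + expR 2 * expR (- (2 * T)) * (v x * H x)))).
  apply: ler_sum => x _.
  have := ler_wpM2l (v0 x) (stepG x _); rewrite size_tuple => /(_ erefl); lra.
rewrite !big_split/= -!mulr_sumr -mulr_suml -/(mass n v) -/V.
have -> : \sum_(x : n.-tuple bool) \sum_(y : n.-tuple bool) v x * w y *
     expR (- (kappa ^+ 2 / (96 * T) * Q x y)) = \sum_(x : n.-tuple bool) v x * G x.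
  apply: eq_bigr => x _; rewrite mulr_sumr; apply: eq_bigr => y _; by rewrite mulrA.
rewrite mulrDr [leRHS]addrC addrAC addrC lerD2l.
have := ler_wpM2l (mulr_ge0 (expR_ge0 2) (expR_ge0 (- (2 * T)))) HV.
have : (1 + expR 2) * (V * m * expR (- (2 * T))) <= expR 3 * (V * m * expR (- (2 * T))).
  apply: ler_wpM2r; first by rewrite !mulr_ge0 ?expR_ge0.
  rewrite E3; have := ler_wpM2r (expR_ge0 2) E1; lra.
lra.
Qed.

(** * The Cauchy-Davenport theorem *)

Definition sumset {G : finZmodType} (A B : {set G}) : {set G} :=
  [set a + b | a in A, b in B]%SET.

Lemma sumsetP {G : finZmodType} (A B : {set G}) x :
  reflect (exists a b, [/\ a \in A, b \in B & x = a + b]) (x \in sumset A B).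
Proof.
apply: (iffP imset2P) => [[a b aA bB ->]|[a [b [aA bB ->]]]]; first by exists a, b.
exact: Imset2spec aA bB erefl.
Qed.

(** Dyson's e-transform: if A is not stable under a difference b2 - b1 of
    elements of B, a translate B' of B meets A without being contained in it.
    Replacing (A, B') by their union and intersection keeps the sum of the sizes,
    does not enlarge the sumset, and makes the second set smaller. *)
Lemma cauchy_davenport (p : nat) (A B : {set 'F_p}) : prime p ->
  A != finset.set0 -> B != finset.set0 -> (minn p (#|A| + #|B|).-1 <= #|sumset A B|)%N.
Proof.
move=> p_pr A0 B0.
have [k] := ubnP #|B|; elim: k A B A0 B0 => // k IH A B A0 B0 leBk.
have [B1|] := leqP #|B| 1.
  have /cards1P[b ->] : #|B| == 1%N by rewrite eqn_leq B1 card_gt0.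
  rewrite cards1 addn1 /= geq_min; apply/orP; right.
  rewrite -(card_imset (mem A) (addIr b)); apply: subset_leq_card.
  apply/fintype.subsetP => _ /imsetP[a aA ->]; apply/sumsetP; exists a, b; split=> //.
  by rewrite finset.inE.
move=> /card_gt1P[b1 [b2 [b1B b2B b12]]].
pose d := b2 - b1.
have d0 : d != 0 by rewrite subr_eq0 eq_sym.
have shift_card (e : 'F_p) (S : {set 'F_p}) : #|[set x + e | x in S]%SET| = #|S|.
  exact: card_imset (addIr e).
have [/forall_inP stab|/forall_inPn/= [a aA adA]] := boolP [forall a in A, a + d \in A].
  rewrite geq_min; apply/orP; left.
  have AT x : x \in A.
    move/set0Pn: A0 => [a0 a0A].
    have st j : a0 + d *+ j \in A.
      elim: j => [|j IHj]; first by rewrite mulr0n addr0.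
      by rewrite mulrSr addrA; apply: stab.
    have -> : x = a0 + d *+ (((x - a0) / d) : 'F_p).
      by rewrite -mulr_natr natr_Zp mulrC divfK// addrC subrK.
    exact: st.
  rewrite -{1}(card_Fp p_pr) -cardsT -(shift_card b1); apply: subset_leq_card.
  apply/fintype.subsetP => _ /imsetP[x _ ->]; apply/sumsetP; exists x, b1; split => //.
pose e := a - b1.
pose B' := [set b + e | b in B]%SET.
have cB' : #|B'| = #|B| by exact: shift_card.
pose C := A :&: B'; pose U := A :|: B'.
have aC : a \in C.
  rewrite finset.inE aA; apply/imsetP; exists b1 => //; by rewrite /e addrC subrK.
have U0 : U != finset.set0 by apply/set0Pn; exists a; rewrite finset.inE aA.
have C0 : C != finset.set0 by apply/set0Pn; exists a.
have ltC : (#|C| < #|B|)%N.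
  rewrite -cB'; apply: proper_card; apply/properP; split; first exact: finset.subsetIr.
  exists (a + d); last by rewrite finset.inE (negPf adA).
  by apply/imsetP; exists b2 => //; rewrite /d /e; ring.
have := IH U C U0 C0 (leq_trans ltC leBk).
rewrite cardsUI cB' => /leq_trans; apply.
rewrite -(shift_card e (sumset A B)); apply: subset_leq_card.
apply/fintype.subsetP => _ /sumsetP[u [c [uU cC ->]]].
move: cC; rewrite finset.inE => /andP[cA /imsetP[c' c'B cE]].
move: uU; rewrite finset.inE => /orP[uA|/imsetP[u' u'B ->]].
  apply/imsetP; exists (u + c'); last by rewrite cE addrA.
  by apply/sumsetP; exists u, c'.
apply/imsetP; exists (c + u'); last by rewrite addrC addrA.
by apply/sumsetP; exists c, u'.
Qed.

(** * Level sets of the dispersion *)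

Lemma cos_int_period (x : R) (z : int) : cos (x + 2 * pi * z%:~R) = cos x.
Proof.
have nat_period (y : R) (n : nat) : cos (y + 2 * pi * n%:R) = cos y.
  have -> : 2 * pi * n%:R = pi *+ 2 *+ n :> R by rewrite mulr_natl mulr_natr.
  exact: (@periodicn R R cos (pi *+ 2) (@cosD2pi R)).
case: z => n; first exact: nat_period.
by rewrite NegzE mulrNz mulrN -pmulrn -[LHS](nat_period _ n.+1) addrNK.
Qed.

Lemma sin_int_period (x : R) (z : int) : sin (x + 2 * pi * z%:~R) = sin x.
Proof. by rewrite -!cosBpihalf addrAC cos_int_period. Qed.

Definition freq (p : nat) (a : 'F_p) (k : int) : R :=
  2 * pi * ((a : nat)%:R * k%:~R / p%:R).

Lemma freqD p a k l : freq p a (k + l) = freq p a k + freq p a l.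
Proof. by rewrite /freq intrD; ring. Qed.
Lemma freqN p a k : freq p a (- k) = - freq p a k.
Proof. by rewrite /freq mulrNz; ring. Qed.

Lemma sum_cos_freq0 (p : nat) : prime p -> \sum_(a : 'F_p) cos (freq p a 0) = p%:R.
Proof.
move=> p_pr; under eq_bigr do rewrite /freq mulr0 mul0r mulr0 cos0.
by rewrite sumr_const card_Fp.
Qed.

(** Multiplied by 2 sin (h / 2), the sum telescopes to a difference of sines over a whole
    number of periods. *)
Lemma sum_cos_freq (p : nat) (k : int) : prime p -> k != 0 -> (`|k|%N < p)%N ->
  \sum_(a : 'F_p) cos (freq p a k) = 0.
Proof.
move=> p_pr k0 kp.
have p0 : p%:R != 0 :> R by rewrite pnatr_eq0 -lt0n prime_gt0.
pose h : R := 2 * pi * (k%:~R / p%:R).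
have -> : \sum_(a : 'F_p) cos (freq p a k) = \sum_(0 <= i < p) cos (i%:R * h).
  rewrite big_mkord (eq_bigr (fun a : 'F_p => cos ((a : nat)%:R * h))); last first.
    by move=> a _; congr cos; rewrite /freq /h; ring.
  have e : (Zp_trunc (pdiv p)).+2 = p by exact: Fp_cast.
  by rewrite -(big_mkord xpredT (fun i => cos (i%:R * h))) -(big_mkord xpredT (fun i => cos (i%:R * h))) e.
have sh : sin (h / 2) != 0.
  have -> : h / 2 = pi * (k%:~R / p%:R) by rewrite /h; field.
  have [kpos|kneg] := leP 0 k.
    apply/lt0r_neq0/sin_gt0_pi/andP; split.
      by rewrite mulr_gt0 ?pi_gt0// divr_gt0 ?ltr0n ?prime_gt0// ltr0z lt_def k0.
    rewrite -[ltRHS]mulr1 ltr_pM2l ?pi_gt0// ltr_pdivrMr ?ltr0n ?prime_gt0// mul1r.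
    by rewrite -(ger0_norm kpos) -abszE -pmulrn ltr_nat.
  have -> : pi * (k%:~R / p%:R) = - (pi * ((- k)%:~R / p%:R)) :> R.
    by rewrite mulrNz; ring.
  rewrite sinN oppr_eq0.
  apply/lt0r_neq0/sin_gt0_pi/andP; split.
    by rewrite mulr_gt0 ?pi_gt0// divr_gt0 ?ltr0n ?prime_gt0// ltr0z oppr_gt0.
  rewrite -[ltRHS]mulr1 ltr_pM2l ?pi_gt0// ltr_pdivrMr ?ltr0n ?prime_gt0// mul1r.
  by rewrite -(ltr0_norm kneg) -abszE -pmulrn ltr_nat.
have tel n : 2 * sin (h / 2) * \sum_(0 <= i < n) cos (i%:R * h) =
    sin (n%:R * h - h / 2) + sin (h / 2).
  elim: n => [|n IHn].
    by rewrite big_geq// mulr0 mul0r sub0r sinN addNr.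
  rewrite big_nat_recr//= mulrDr IHn.
  have -> : n.+1%:R * h - h / 2 = n%:R * h + h / 2 by rewrite -natr1; field.
  by rewrite sinB sinD; ring.
have := tel p.
have -> : p%:R * h - h / 2 = - (h / 2) + 2 * pi * k%:~R by rewrite /h; field.
rewrite sin_int_period sinN addNr => /eqP.
by rewrite !mulf_eq0 (negPf sh) pnatr_eq0/= => /eqP.
Qed.

Lemma cos_freqDl (p : nat) (a b : 'F_p) k : prime p ->
  cos (freq p (a + b) k) = cos (freq p a k + freq p b k).
Proof.
move=> p_pr.
have p0 : p%:R != 0 :> R by rewrite pnatr_eq0 -lt0n prime_gt0.
have ab : ((a + b)%R = ((a : nat) + (b : nat)) %% p :> nat)%N by congr (_ %% _)%N; exact: Fp_cast.
have -> : freq p a k + freq p b k =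
   freq p (a + b) k + 2 * pi * ((((a : nat) + (b : nat)) %/ p)%N%:Z * k)%:~R.
  rewrite /freq ab intrM.
  have : ((a : nat) + (b : nat))%:R = (((a + b) %/ p)%N * p + ((a + b) %% p)%N)%N%:R :> R.
    by rewrite -divn_eq.
  rewrite !natrD natrM => E.
  have -> : 2 * pi * ((a : nat)%:R * k%:~R / p%:R) + 2 * pi * ((b : nat)%:R * k%:~R / p%:R)
    = 2 * pi * (((a : nat)%:R + (b : nat)%:R) * k%:~R / p%:R) :> R by ring.
  by rewrite E; field.
by rewrite cos_int_period.
Qed.

Definition dispersion (p : nat) (J : seq int) (a : 'F_p) : R :=
  \sum_(k <- J) (1 - cos (freq p a k)).

Lemma one_sub_cos_ge0 (x : R) : 0 <= 1 - cos x.
Proof. by rewrite subr_ge0 cos_le1. Qed.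

Lemma dispersion_ge0 p J a : 0 <= dispersion p J a.
Proof. by apply: sumr_ge0 => k _; exact: one_sub_cos_ge0. Qed.

(** One minus a cosine is half a squared chord, and chords are subadditive. *)
Lemma one_sub_cosD (x y : R) : 1 - cos (x + y) <= 2 * (1 - cos x) + 2 * (1 - cos y).
Proof.
rewrite cosD; have := cos2Dsin2 x; have := cos2Dsin2 y.
move: (cos x) (sin x) (cos y) (sin y) => c s c' s' h h'.
have := sqr_ge0 (c + c' - 2); have := sqr_ge0 (s - s').
have := sqr_ge0 (c - c'); have := sqr_ge0 (s + s').
move=> *; nra.
Qed.

Lemma dispersionD (p : nat) J (a b : 'F_p) : prime p ->
  dispersion p J (a + b) <= 2 * dispersion p J a + 2 * dispersion p J b.
Proof.
move=> p_pr; rewrite /dispersion !mulr_sumr -big_split/=; apply: ler_sum => k _.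
by rewrite cos_freqDl//; exact: one_sub_cosD.
Qed.

Lemma dispersion0 (p : nat) J : dispersion p J 0 = 0.
Proof.
by rewrite /dispersion big1// => k _; rewrite /freq mul0r mul0r mulr0 cos0 subrr.
Qed.

Lemma sum_dispersion (p : nat) J : prime p ->
  (forall k, k \in J -> k != 0 /\ (`|k|%N < p)%N) ->
  \sum_(a : 'F_p) dispersion p J a = p%:R * (size J)%:R.
Proof.
move=> p_pr HJ; rewrite /dispersion exchange_big/= big_seq.
rewrite (eq_bigr (fun=> p%:R)) => [|k /HJ[k0 kp]].
  by rewrite -big_seq big_const_seq count_predT iter_addr addr0 mulr_natr.
by rewrite sumrB sumr_const card_Fp// sum_cos_freq// subr0.
Qed.

Definition level (p : nat) J (L : R) : {set 'F_p} :=
  [set a : 'F_p | dispersion p J a <= L]%SET.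

(** The level set at 4 L contains the sumset of the one at L with itself.  It is
    not all of F_p, because the mean of the dispersion is the size of J. *)
Lemma card_level_double (p : nat) J L : prime p ->
  (forall k, k \in J -> k != 0 /\ (`|k|%N < p)%N) ->
  0 <= L -> 4 * L < (size J)%:R ->
  (2 * #|level p J L| <= #|level p J (4 * L)|.+1)%N.
Proof.
move=> p_pr HJ L0 LJ.
set T := level p J L; set T4 := level p J (4 * L).
have zT : 0 \in T by rewrite finset.inE dispersion0.
have T0 : T != finset.set0 by apply/set0Pn; exists 0.
have sub : (#|sumset T T| <= #|T4|)%N.
  apply: subset_leq_card; apply/fintype.subsetP => _ /sumsetP[a [b [aT bT ->]]].
  move: aT bT; rewrite !finset.inE => aT bT.
  by apply: (le_trans (dispersionD _ _ _ _ p_pr)); lra.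
have lt : (#|T4| < p)%N.
  rewrite ltnNge; apply/negP => full.
  have all4 a : a \in T4.
    have /eqP -> : T4 == finset.setT by rewrite eqEcard finset.subsetT cardsT card_Fp.
    by rewrite finset.inE.
  have := sum_dispersion p J p_pr HJ.
  have : \sum_(a : 'F_p) dispersion p J a <= \sum_(a : 'F_p) 4 * L.
    by apply: ler_sum => a _; have := all4 a; rewrite finset.inE.
  rewrite sumr_const card_Fp// => h E; move: h; rewrite E -[leRHS]mulr_natl.
  rewrite ler_pM2l ?ltr0n ?prime_gt0// => h; have := le_lt_trans h LJ.
  by rewrite ltxx.
have := leq_trans (cauchy_davenport p T T p_pr T0 T0) sub.
rewrite geq_min => /orP[h|h]; first by move: (leq_ltn_trans h lt); rewrite ltnn.
by rewrite mul2n -addnn; move: h; case: (_ + _)%N.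
Qed.

Lemma card_level_scale (p : nat) J k L : prime p ->
  (forall k, k \in J -> k != 0 /\ (`|k|%N < p)%N) ->
  0 <= L -> 4 ^+ k * L < (size J)%:R ->
  #|level p J L|%:R <= 1 + (1 / 2) ^+ k * #|level p J (4 ^+ k * L)|%:R :> R.
Proof.
move=> p_pr HJ; elim: k L => [|k IH] L L0 LJ.
  by rewrite !expr0 mul1r mul1r lerDr.
have L4 : 4 * L < (size J)%:R.
  apply: le_lt_trans LJ; rewrite exprS -mulrA ler_wpM2l// ler_peMl//.
  by rewrite exprn_ege1//; lra.
have := IH (4 * L) ltac:(lra); rewrite mulrA -exprSr => /(_ LJ) h.
have := card_level_double p J L p_pr HJ L0 L4.
rewrite -(ler_nat R) natrM -natr1 => h2.
rewrite [(1 / 2) ^+ k.+1]exprS -[1 / 2 * _ * _]mulrA; lra.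
Qed.

(** For x in ]4^(k-1), 4^k], exp (-x) <= 1 / x < 4 * 4^(-k). *)
Lemma expRN_dyadic (K : nat) (x : R) : 0 <= x -> x <= 4 ^+ K ->
  expR (- x) <= 4 * \sum_(0 <= k < K.+1) (1 / 4) ^+ k * (x <= 4 ^+ k)%R%:R.
Proof.
move=> x0; elim: K => [|K IH].
  rewrite big_nat1 !expr0 => ->; rewrite !mulr1.
  by apply: (@le_trans _ _ 1); [rewrite expR_le1 oppr_le0 | lra].
move=> xK; rewrite big_nat_recr//= mulrDr.
have [/IH h|lt] := leP x (4 ^+ K).
  by apply: (le_trans h); rewrite lerDl !mulr_ge0// exprn_ge0//; lra.
rewrite -[leLHS]add0r; apply: lerD.
  by rewrite mulr_ge0// sumr_ge0// => i _; rewrite mulr_ge0// exprn_ge0//; lra.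
have xp : 0 < x by apply: lt_trans lt; rewrite exprn_gt0//; lra.
have e1 : expR (- x) <= x^-1.
  rewrite expRN lef_pV2 ?posrE ?expR_gt0//.
  by have := expR_ge1Dx x; lra.
rewrite xK mulr1; apply: (le_trans e1).
have -> : 4 * (1 / 4) ^+ K.+1 = (4 ^+ K)^-1 :> R.
  by rewrite exprS div1r exprVn mulrA divff ?mul1r// gt_eqF//; lra.
rewrite lef_pV2 ?posrE ?exprn_gt0//; first exact: ltW.
Qed.

(** At the dyadic level k, the weight 4^(-k) outweighs the growth 2^k of the level
    sets allowed by [card_level_scale], so the sum is dominated by its first terms. *)
Lemma sum_expR_dispersion_K (p : nat) J (lam : R) (K : nat) : prime p ->
  (forall k, k \in J -> k != 0 /\ (`|k|%N < p)%N) -> (0 < size J)%N ->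
  0 < lam -> 4 ^+ K <= lam * (size J)%:R / 4 ->
  \sum_(a : 'F_p) expR (- (lam * dispersion p J a)) <=
   8 * (1 + (1 / 2) ^+ K * #|level p J ((size J)%:R / 4)|%:R) + p%:R * expR (- 4 ^+ K).
Proof.
move=> p_pr HJ J0 lam0 HK.
have J0' : 0 < (size J)%:R :> R by rewrite ltr0n.
have pos4 k : 0 < 4 ^+ k :> R by rewrite exprn_gt0//; lra.
have pt a : expR (- (lam * dispersion p J a)) <=
  4 * \sum_(0 <= k < K.+1) (1 / 4) ^+ k * (lam * dispersion p J a <= 4 ^+ k)%R%:R + expR (- 4 ^+ K).
  have D0 : 0 <= lam * dispersion p J a by rewrite mulr_ge0 ?dispersion_ge0 ?(ltW lam0).
  have [le|/ltW ge] := leP (lam * dispersion p J a) (4 ^+ K).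
    by apply: (le_trans (expRN_dyadic K _ D0 le)); rewrite lerDl expR_ge0.
  rewrite -[leLHS]add0r; apply: lerD; last by rewrite ler_expR lerN2.
  by rewrite mulr_ge0// sumr_ge0// => i _; rewrite mulr_ge0// exprn_ge0//; lra.
apply: le_trans (ler_sum _ (fun a _ => pt a)) _.
rewrite big_split/= sumr_const card_Fp// -[_ *+ p]mulr_natl lerD2r.
rewrite -mulr_sumr exchange_big/=.
have cnt k : \sum_(a : 'F_p) (1 / 4) ^+ k * (lam * dispersion p J a <= 4 ^+ k)%R%:R
   = (1 / 4) ^+ k * #|level p J (4 ^+ k / lam)|%:R :> R.
  rewrite -mulr_sumr -natr_sum /level -sum1dep_card; congr (_ * _%:R).
  rewrite [RHS]big_mkcond/=; apply: eq_bigr => a _.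
  by rewrite ler_pdivlMr// [_ * lam]mulrC; case: ifP.
rewrite (eq_bigr _ (fun k _ => cnt k)).
set X := 1 + _ * _.
have X0 : 0 <= X by rewrite addr_ge0// mulr_ge0// exprn_ge0//; lra.
have tm k : (k < K.+1)%N -> (1 / 4) ^+ k * #|level p J (4 ^+ k / lam)|%:R <= (1 / 2) ^+ k * X.
  rewrite ltnS => kK.
  have L0 : 0 <= 4 ^+ k / lam by rewrite divr_ge0 ?(ltW (pos4 k)) ?(ltW lam0).
  have scE : 4 ^+ (K - k) * (4 ^+ k / lam) = 4 ^+ K / lam by rewrite mulrA -exprD subnK.
  have le4 : 4 ^+ K / lam <= (size J)%:R / 4.
    by rewrite ler_pdivrMr//; lra.
  have := card_level_scale p J (K - k) (4 ^+ k / lam) p_pr HJ L0.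
  rewrite scE => /(_ ltac:(by apply: (le_lt_trans le4); lra)) h.
  have mono : #|level p J (4 ^+ K / lam)|%:R <= #|level p J ((size J)%:R / 4)|%:R :> R.
    rewrite ler_nat; apply: subset_leq_card; apply/fintype.subsetP => a.
    by rewrite !finset.inE => /le_trans; apply.
  have half0 i : 0 <= (1 / 2) ^+ i :> R by rewrite exprn_ge0//; lra.
  have -> : (1 / 4) ^+ k = (1 / 2) ^+ k * (1 / 2) ^+ k :> R.
    by rewrite -exprMn; congr (_ ^+ _); field.
  rewrite -mulrA; apply: ler_wpM2l => //.
  apply: (le_trans (ler_wpM2l (half0 k) h)).
  rewrite mulrDr mulr1; apply: lerD; first by rewrite exprn_ile1//; lra.
  by rewrite mulrA -exprD subnKC//; apply: ler_wpM2l.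
apply: (@le_trans _ _ (4 * \sum_(0 <= k < K.+1) (1 / 2) ^+ k * X)).
  by apply: ler_wpM2l => //; rewrite big_nat [leRHS]big_nat; apply: ler_sum => k /andP[_ /tm].
have geo n : \sum_(0 <= k < n) (1 / 2) ^+ k <= 2 - (1 / 2) ^+ n *+ 2 :> R.
  elim: n => [|n IHn]; first by rewrite big_geq// expr0; lra.
  by rewrite big_nat_recr//= exprS; lra.
rewrite -mulr_suml mulrA; apply: ler_wpM2r => //.
have := geo K.+1; have : 0 <= (1 / 2) ^+ K.+1 :> R by rewrite exprn_ge0//; lra.
lra.
Qed.

(** [sum_expR_dispersion_K] for the largest K with 4^K <= lam |J| / 4; if there is
    none, the last term exceeds the trivial bound p. *)
Lemma sum_expR_dispersion (p : nat) J (lam : R) : prime p ->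
  (forall k, k \in J -> k != 0 /\ (`|k|%N < p)%N) -> (0 < size J)%N ->
  0 < lam ->
  \sum_(a : 'F_p) expR (- (lam * dispersion p J a)) <=
   8 + 32 * #|level p J ((size J)%:R / 4)|%:R / Num.sqrt (lam * (size J)%:R) +
   2 * p%:R * expR (- (lam * (size J)%:R / 16)).
Proof.
move=> p_pr HJ J0 lam0.
set N := #|_|%:R; set s := lam * _.
have s0 : 0 < s by rewrite mulr_gt0// ltr0n.
have q0 : 0 < Num.sqrt s by rewrite sqrtr_gt0.
have N0 : 0 <= N by [].
have [ge|lt] := leP 1 (s / 4); last first.
  apply: (@le_trans _ _ p%:R).
    have <- : \sum_(a : 'F_p) 1 = p%:R :> R by rewrite sumr_const card_Fp.
    apply: ler_sum => a _; rewrite expR_le1 oppr_le0.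
    by rewrite mulr_ge0 ?dispersion_ge0 ?(ltW lam0).
  have : 1 - s / 16 <= expR (- (s / 16)) by exact: expR_ge1Dx.
  have : 0 <= 32 * N / Num.sqrt s by rewrite divr_ge0 ?mulr_ge0 ?(ltW q0).
  have p0 : 0 < p%:R :> R by rewrite ltr0n prime_gt0.
  move=> ? h; have : p%:R * (1 / 2) <= p%:R * expR (- (s / 16)).
    by apply: ler_wpM2l; [exact: ltW | lra].
  lra.
have [K /andP[K1 K2]] : exists K : nat, (4 ^+ K <= s / 4) && (s / 4 < 4 ^+ K.+1).
  pose P (k : nat) := 4 ^+ k <= s / 4.
  have P0 : exists k, P k by exists 0%N; rewrite /P expr0.
  have ub k : P k -> (k <= Num.bound (s / 4))%N.
    rewrite /P => Pk; apply: ltnW; rewrite -(ltr_nat R).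
    apply: (@lt_trans _ _ (4 ^+ k)).
      rewrite -natrX ltr_nat; exact: ltn_expl.
    apply: (le_lt_trans Pk); apply: archi_boundP; lra.
  case: (ex_maxnP P0 ub) => K PK Kmax; exists K; apply/andP; split=> //; rewrite ltNge.
  by apply/negP => /Kmax; rewrite ltnn.
apply: (le_trans (sum_expR_dispersion_K p J lam K p_pr HJ J0 lam0 K1)).
rewrite mulrDr mulr1 -/N.
have i1 : 8 * ((1 / 2) ^+ K * N) <= 32 * N / Num.sqrt s.
  have h : (1 / 2) ^+ K <= 4 / Num.sqrt s.
    rewrite ler_pdivlMr// div1r exprVn mulrC ler_pdivrMr ?exprn_gt0//.
    rewrite -ler_sqr ?nnegrE ?(ltW q0) ?mulr_ge0 ?exprn_ge0//.
    rewrite sqr_sqrtr ?(ltW s0)// exprMn -exprM mulnC exprM.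
    have -> : 2 ^+ 2 = 4 :> R by rewrite expr2; lra.
    move: K2; rewrite exprS; lra.
  have := ler_wpM2r N0 h; lra.
have i2 : p%:R * expR (- 4 ^+ K) <= 2 * p%:R * expR (- (s / 16)).
  have : expR (- 4 ^+ K) <= expR (- (s / 16)).
    by rewrite ler_expR lerN2; move: K2; rewrite exprS; lra.
  move=> /(ler_wpM2l (ler0n R p)).
  have : 0 <= p%:R * expR (- (s / 16)) by rewrite mulr_ge0 ?expR_ge0.
  lra.
lra.
Qed.

(** * Moments and the top level set *)

Lemma sum_sqr_cos (p : nat) (M : seq int) : prime p ->
  (forall a : 'F_p, \sum_(m <- M) sin (freq p a m) = 0) ->
  (forall k l, k \in M -> l \in M -> (`|k - l|%N < p)%N) ->
  \sum_(a : 'F_p) (\sum_(m <- M) cos (freq p a m)) ^+ 2 =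
  p%:R * (\sum_(k <- M) \sum_(l <- M) (k == l))%N%:R.
Proof.
move=> p_pr sin0 Mp.
have sq (a : 'F_p) : (\sum_(m <- M) cos (freq p a m)) ^+ 2 =
  \sum_(k <- M) \sum_(l <- M) cos (freq p a (k - l)).
  have -> : (\sum_(m <- M) cos (freq p a m)) ^+ 2 =
    (\sum_(m <- M) cos (freq p a m)) * (\sum_(m <- M) cos (freq p a m)) +
    (\sum_(m <- M) sin (freq p a m)) * (\sum_(m <- M) sin (freq p a m)).
    by rewrite sin0 mul0r addr0.
  rewrite !mulr_suml -big_split/=; apply: eq_bigr => k _.
  rewrite !mulr_sumr -big_split/=; apply: eq_bigr => l _.
  by rewrite freqD freqN cosB.
rewrite (eq_bigr _ (fun a _ => sq a)) exchange_big/= natr_sum mulr_sumr.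
rewrite big_seq [RHS]big_seq; apply: eq_bigr => k kM.
rewrite exchange_big/= natr_sum mulr_sumr.
rewrite big_seq [RHS]big_seq; apply: eq_bigr => l lM.
have [<-|kl] := eqVneq k l; first by rewrite subrr sum_cos_freq0// mulr1.
by rewrite sum_cos_freq ?mulr0 ?subr_eq0// Mp.
Qed.

(** Adding the opposites makes the sums of sines vanish, so that the sum of
    cosines is the whole exponential sum. *)
Definition signed (J : seq int) := J ++ [seq - k | k <- J].

Lemma sum_cos_signed p a J : \sum_(m <- signed J) cos (freq p a m) =
  2 * \sum_(k <- J) cos (freq p a k).
Proof.
rewrite big_cat big_map/= [X in _ + X](eq_bigr (fun k => cos (freq p a k))).
  by rewrite mulr_natl mulr2n.
by move=> k _; rewrite freqN cosN.
Qed.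

Lemma sum_sin_signed p a J : \sum_(m <- signed J) sin (freq p a m) = 0.
Proof.
rewrite big_cat big_map/= [X in _ + X](eq_bigr (fun k => - sin (freq p a k))).
  by rewrite sumrN subrr.
by move=> k _; rewrite freqN sinN.
Qed.

Lemma level_sum_cos (p : nat) J (a : 'F_p) : a \in level p J ((size J)%:R / 4) ->
  3 / 2 * (size J)%:R <= \sum_(m <- signed J) cos (freq p a m).
Proof.
rewrite finset.inE /dispersion sumrB sum_cos_signed.
have -> : \sum_(i <- J) 1 = (size J)%:R :> R.
  by rewrite big_const_seq count_predT iter_addr addr0.
by move=> h; lra.
Qed.

Lemma card_level_moment (p : nat) J (r : nat) (B : R) :
  \sum_(a : 'F_p) (\sum_(m <- signed J) cos (freq p a m)) ^+ (2 * r) <= B ->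
  #|level p J ((size J)%:R / 4)|%:R * (3 / 2 * (size J)%:R) ^+ (2 * r) <= B.
Proof.
move=> HB; apply: le_trans HB.
rewrite -sum1_card natr_sum mulr_suml big_mkcond/=; apply: ler_sum => a _.
have ev : 0 <= (\sum_(m <- signed J) cos (freq p a m)) ^+ (2 * r).
  by rewrite exprM exprn_ge0 ?sqr_ge0.
case: ifP => // al; rewrite mul1r; apply: lerXn2r.
- by rewrite nnegrE mulr_ge0.
- rewrite nnegrE; apply: le_trans (level_sum_cos _ _ _ al); rewrite mulr_ge0//.
- exact: level_sum_cos.
Qed.

Lemma signed_bound J (M : nat) : (forall k, k \in J -> (`|k|%N <= M)%N) ->
  forall k, k \in signed J -> (`|k|%N <= M)%N.
Proof.
by move=> HJ k; rewrite mem_cat => /orP[/HJ//|/mapP[l /HJ lM ->]]; rewrite abszN.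
Qed.

(** A second moment: each frequency occurs at most twice in the signed list. *)
Lemma card_level_uniq (p : nat) J (M : nat) : prime p -> uniq J ->
  (forall k, k \in J -> (`|k|%N <= M)%N) -> (2 * M < p)%N ->
  #|level p J ((size J)%:R / 4)|%:R * (size J)%:R ^+ 2 <= 2 * p%:R * (size J)%:R :> R.
Proof.
move=> p_pr uJ HJ Mp.
have Hs := signed_bound J M HJ.
have /card_level_moment : \sum_(a : 'F_p) (\sum_(m <- signed J) cos (freq p a m)) ^+ (2 * 1)
   <= p%:R * (4 * size J)%N%:R.
  rewrite muln1 sum_sqr_cos//; last first.
  - move=> k l /Hs kM /Hs lM; lia.
  - by move=> a; exact: sum_sin_signed.
  apply: ler_wpM2l => //; rewrite ler_nat.
  apply: (@leq_trans (\sum_(k <- signed J) 2)%N).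
    apply: leq_sum => k _; rewrite big_cat big_map/=.
    have c1 : (\sum_(l <- J) (k == l) <= 1)%N.
      have -> : (\sum_(l <- J) (k == l) = count_mem k J)%N.
        by rewrite -sum1_count [RHS]big_mkcond/=; apply: eq_bigr => l _; rewrite eq_sym; case: eqP.
      by rewrite count_uniq_mem//; case: (_ \in _).
    have c2 : (\sum_(l <- J) (k == - l) <= 1)%N.
      have -> : (\sum_(l <- J) (k == - l)%R = count_mem (- k)%R J)%N.
        rewrite -sum1_count [RHS]big_mkcond/=; apply: eq_bigr => l _.
        by rewrite -eqr_oppLR eq_sym; case: eqP.
      by rewrite count_uniq_mem//; case: (_ \in _).
    exact: leq_add c1 c2.
  rewrite big_const_seq count_predT iter_addn addn0 /signed size_cat size_map; by rewrite addnn -mul2n mulnA.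
rewrite muln1 natrM; have : 0 <= #|level p J ((size J)%:R / 4)|%:R * (size J)%:R ^+ 2 :> R.
  by rewrite mulr_ge0// exprn_ge0.
rewrite exprMn; lra.
Qed.

Lemma sum_signed_le (S : {fset int}) (J0 : seq int) (f : int -> nat) : uniq J0 ->
  {subset J0 <= S} ->
  (\sum_(m <- signed [seq (2 * s)%R | s <- J0]) f m <=
   \sum_(z : signs * S) f (val z.1 * (2 * val z.2))%R)%N.
Proof.
move=> uJ sJ.
rewrite -(pair_bigA _ (fun (e : signs) (s : S) => f (val e * (2 * val s))%R)) /=.
rewrite -(big_seq_fsetE _ signs xpredT (fun e => \sum_(s : S) f (e * (2 * val s))%R)%N) /=.
rewrite /signs big_fsetU1 ?inE//= big_seq_fset1.
rewrite big_cat !big_map/=.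
have le (g : int -> nat) : (\sum_(s <- J0) g s <= \sum_(s : S) g (val s))%N.
  rewrite -(big_seq_fsetE _ S xpredT g) /=.
  by apply: (uniq_sub_le_big leqnn (fun x y => leq_addr y x)); rewrite ?fset_uniq.
apply: leq_add.
  by under [X in (_ <= X)%N]eq_bigr do rewrite mul1r; exact: (le (fun s => f (2 * s)%R)).
by under [X in (_ <= X)%N]eq_bigr do rewrite mulN1r; exact: (le (fun s => f (- (2 * s))%R)).
Qed.

(** Each signed element 2 s of the list is coded by its sign and by s, so
    solutions in the list inject into the sign and element tuples of S. *)
Lemma sidon_count (S : {fset int}) (J0 : seq int) : uniq J0 -> {subset J0 <= S} ->
  (\sum_(m1 <- signed [seq (2 * s)%R | s <- J0])
   \sum_(m2 <- signed [seq (2 * s)%R | s <- J0])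
   \sum_(m3 <- signed [seq (2 * s)%R | s <- J0])
   \sum_(m4 <- signed [seq (2 * s)%R | s <- J0]) ((m1 + m2)%R == (m3 + m4)%R)
   <= #|sidon_solutions S|)%N.
Proof.
move=> uJ sJ.
have le f := sum_signed_le S J0 f uJ sJ.
apply: (leq_trans (le _)).
apply: (leq_trans (leq_sum _ (fun z1 _ => le _))).
apply: (leq_trans (leq_sum _ (fun z1 _ => leq_sum _ (fun z2 _ => le _)))).
apply: (leq_trans (leq_sum _ (fun z1 _ => leq_sum _ (fun z2 _ =>
   leq_sum _ (fun z3 _ => le _))))).
under eq_bigr do under eq_bigr do rewrite pair_bigA.
under eq_bigr do rewrite pair_bigA.
rewrite pair_bigA/=.
pose h (q : (signs * signs * signs * signs) * (S * S * S * S)) :=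
  let: ((e1, e2, e3, e4), (s1, s2, s3, s4)) := q in
  ((e1, s1), ((e2, s2), ((e3, s3), (e4, s4)))).
pose h' (q : (signs * S) * ((signs * S) * ((signs * S) * (signs * S)))) :=
  let: ((e1, s1), ((e2, s2), ((e3, s3), (e4, s4)))) := q in
  ((e1, e2, e3, e4), (s1, s2, s3, s4)).
rewrite (reindex h) /=; last first.
  exists h' => [[[[[e1 e2] e3] e4] [[[s1 s2] s3] s4]]|[[e1 s1] [[e2 s2] [[e3 s3] [e4 s4]]]]] //.
rewrite -sum1dep_card [leqRHS]big_mkcond/=; apply: leq_sum => -[[[[e1 e2] e3] e4] [[[s1 s2] s3] s4]] _ /=.
have -> : forall (a b c d e f g i : int), (a * (2 * b) + c * (2 * d) == e * (2 * f) + g * (2 * i)) =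
   (a * b + c * d == e * f + g * i).
  move=> a b c d e f g i; apply/eqP/eqP; nia.
by case: eqP.
Qed.

(** A fourth moment: the square of the exponential sum is the exponential sum of
    the list of pairwise sums, to which [sum_sqr_cos] applies again. *)
Lemma card_level_sidon (p : nat) (S : {fset int}) (J0 : seq int) (M : nat) :
  prime p -> uniq J0 -> {subset J0 <= S} ->
  (forall k, k \in J0 -> (`|k|%N <= M)%N) -> (8 * M < p)%N ->
  forall J, J = [seq (2 * s)%R | s <- J0] ->
  #|level p J ((size J)%:R / 4)|%:R * (size J)%:R ^+ 4 <=
    1 / 5 * p%:R * #|sidon_solutions S|%:R :> R.
Proof.
move=> p_pr uJ sJ HJ Mp J JE.
have Hs : forall k, k \in signed J -> (`|k|%N <= 2 * M)%N.
  rewrite JE.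
  by apply: signed_bound => _ /mapP[k /HJ kM ->]; rewrite abszM; lia.
pose M2 := [seq (k + l)%R | k <- signed J, l <- signed J].
have E (a : 'F_p) : (\sum_(m <- signed J) cos (freq p a m)) ^+ 2 = \sum_(m <- M2) cos (freq p a m).
  rewrite /M2 big_allpairs_dep/=.
  transitivity ((\sum_(m <- signed J) cos (freq p a m)) * (\sum_(m <- signed J) cos (freq p a m)) -
    (\sum_(m <- signed J) sin (freq p a m)) * (\sum_(m <- signed J) sin (freq p a m))).
    by rewrite sum_sin_signed mul0r subr0 expr2.
  rewrite !mulr_suml -sumrB; apply: eq_bigr => k _.
  rewrite !mulr_sumr -sumrB; apply: eq_bigr => l _.
  by rewrite freqD cosD.
have E0 (a : 'F_p) : \sum_(m <- M2) sin (freq p a m) = 0.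
  rewrite /M2 big_allpairs_dep/=.
  transitivity ((\sum_(m <- signed J) sin (freq p a m)) * (\sum_(m <- signed J) cos (freq p a m)) +
    (\sum_(m <- signed J) cos (freq p a m)) * (\sum_(m <- signed J) sin (freq p a m))).
    rewrite !mulr_suml -big_split/=; apply: eq_bigr => k _.
    rewrite !mulr_sumr -big_split/=; apply: eq_bigr => l _.
    by rewrite freqD sinD.
  by rewrite sum_sin_signed mul0r mulr0 addr0.
have /card_level_moment : \sum_(a : 'F_p) (\sum_(m <- signed J) cos (freq p a m)) ^+ (2 * 2)
   <= p%:R * #|sidon_solutions S|%:R.
  under eq_bigr do rewrite exprM E.
  rewrite sum_sqr_cos//; last first.
    move=> _ _ /allpairsP[[k1 l1] [/Hs k1M /Hs l1M ->]] /allpairsP[[k2 l2] [/Hs k2M /Hs l2M ->]].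
    move: k1M l1M k2M l2M => /=; lia.
  apply: ler_wpM2l => //; rewrite ler_nat.
  apply: leq_trans (sidon_count S J0 uJ sJ); rewrite -JE.
  rewrite /M2 big_allpairs_dep/=; apply: leq_sum => k1 _; apply: leq_sum => l1 _.
  by rewrite big_allpairs_dep.
rewrite exprMn; have : 0 <= #|level p J ((size J)%:R / 4)|%:R * (size J)%:R ^+ 4 :> R.
  by rewrite mulr_ge0// exprn_ge0.
have -> : (3 / 2) ^+ (2 * 2) = 81 / 16 :> R by field.
lra.
Qed.

(** * Rates in n *)

Lemma ln2_ge : 1 / 2 <= ln 2 :> R.
Proof.
have : ln (1 + (2^-1 - 1)) <= 2^-1 - 1 :> R by apply: le_ln1Dx; lra.
rewrite subrKC lnV ?posrE//; lra.
Qed.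

Lemma ln_nat_ge (n : nat) : (2 <= n)%N -> 1 / 2 <= ln n%:R :> R.
Proof.
move=> n2; apply: (le_trans ln2_ge).
by rewrite ler_ln ?posrE ?ltr0n ?ler_nat//; apply: leq_trans n2.
Qed.

Lemma ln_nat_le (n : nat) : (2 <= n)%N -> ln n%:R <= 2 * Num.sqrt n%:R :> R.
Proof.
move=> n2; have n0 : 0 < n%:R :> R by rewrite ltr0n; apply: leq_trans n2.
have s0 : 0 < Num.sqrt n%:R :> R by rewrite sqrtr_gt0.
have -> : ln n%:R = 2 * ln (Num.sqrt n%:R) :> R.
  by rewrite -[in LHS](sqr_sqrtr (ltW n0)) lnXn// mulr_natl.
apply: ler_wpM2l => //.
have := @le_ln1Dx R (Num.sqrt n%:R - 1); rewrite subrKC => /(_ ltac:(lra)); lra.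
Qed.

Lemma expRN_pow_le (k : nat) (x : R) : (0 < k)%N -> 0 < x ->
  expR (- x) <= (k%:R / x) ^+ k.
Proof.
move=> k0 x0; have k0' : 0 < k%:R :> R by rewrite ltr0n.
have y0 : 0 < x / k%:R by rewrite divr_gt0.
have -> : (k%:R / x) ^+ k = ((x / k%:R) ^+ k)^-1 by rewrite -exprVn invf_div.
rewrite expRN lef_pV2 ?posrE ?expR_gt0 ?exprn_gt0//.
have -> : expR x = expR (x / k%:R) ^+ k.
  by rewrite -expRM_natr divfK// gt_eqF.
apply: lerXn2r; rewrite ?nnegrE ?(ltW y0) ?expR_ge0//.
by have := expR_ge1Dx (x / k%:R); lra.
Qed.

(** Every error term below is bounded by a multiple of n^(-3), which this lemma
    compares with the target rate. *)
Lemma natpow3_le_rate (n : nat) (e : R) : (2 <= n)%N -> e <= 5 / 2 ->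
  (n%:R ^+ 3)^-1 <= Num.sqrt (ln n%:R) * n%:R `^ (- e).
Proof.
move=> n2 e52; have n0 : 0 < n%:R :> R by rewrite ltr0n; apply: leq_trans n2.
have n1 : 1 <= n%:R :> R by rewrite ler1n; apply: leq_trans n2.
have n2' : 2 <= n%:R :> R by rewrite ler_nat.
have ln0 := ln_nat_ge n n2.
apply: (@le_trans _ _ (Num.sqrt (ln n%:R) * n%:R `^ (- (5 / 2)))); last first.
  by apply: ler_wpM2l; [exact: sqrtr_ge0 | apply: ler_powR => //; lra].
have -> : - (5 / 2) = - 3 + 2^-1 :> R by lra.
rewrite powRD ?(gt_eqF n0) ?implybT// powR12_sqrt ?(ltW n0)// powR_invn ?(ltW n0)//.
rewrite mulrCA ler_peMr ?invr_ge0 ?exprn_ge0 ?(ltW n0)//.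
rewrite -sqrtrM; last lra.
rewrite -[leLHS]sqrtr1 ler_sqrt; nra.
Qed.

Lemma main_term_rate (n r : nat) (c : R) : (2 <= n)%N -> 0 < c ->
  (n%:R ^+ r)^-1 / Num.sqrt (c / ln n%:R * n%:R) =
  (Num.sqrt c)^-1 * (Num.sqrt (ln n%:R) * n%:R `^ (- (r%:R + 1 / 2))).
Proof.
move=> n2 c0; have n0 : 0 < n%:R :> R by rewrite ltr0n; apply: leq_trans n2.
have ln0 : 0 < ln n%:R :> R by apply: lt_le_trans (ln_nat_ge n n2); lra.
rewrite opprD powRD ?(gt_eqF n0) ?implybT// powR_invn ?(ltW n0)// powRN div1r.
rewrite powR12_sqrt ?(ltW n0)//.
have -> : Num.sqrt (c / ln n%:R * n%:R) =
   Num.sqrt c / Num.sqrt (ln n%:R) * Num.sqrt n%:R.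
  rewrite sqrtrM; last by apply: divr_ge0; exact: ltW.
  by rewrite sqrtrM ?(ltW c0)// sqrtrV// ltW.
by rewrite !invfM !invrK; ring.
Qed.

Lemma exp_term_rate (n : nat) (c : R) : (2 <= n)%N -> 0 < c ->
  expR (- (c / ln n%:R * n%:R / 16)) <= (6 * 32 / c) ^+ 6 * (n%:R ^+ 3)^-1.
Proof.
move=> n2 c0; have n0 : 0 < n%:R :> R by rewrite ltr0n; apply: leq_trans n2.
have ln0 : 0 < ln n%:R :> R by apply: lt_le_trans (ln_nat_ge n n2); lra.
have s0 : 0 < Num.sqrt n%:R :> R by rewrite sqrtr_gt0.
have sE : Num.sqrt n%:R ^+ 2 = n%:R :> R by rewrite sqr_sqrtr// ltW.
pose y := c * Num.sqrt n%:R / 32.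
have y0 : 0 < y by apply: divr_gt0 => //; exact: mulr_gt0.
apply: (@le_trans _ _ (expR (- y))).
  rewrite ler_expR lerN2.
  have -> : c / ln n%:R * n%:R / 16 = (c * n%:R / 16) / ln n%:R by field; rewrite gt_eqF.
  rewrite ler_pdivlMr// /y.
  apply: (@le_trans _ _ (c * Num.sqrt n%:R / 32 * (2 * Num.sqrt n%:R))).
    by apply: ler_wpM2l; [exact: ltW | exact: ln_nat_le].
  by rewrite -[in leRHS]sE; lra.
apply: (le_trans (expRN_pow_le 6 y isT y0)).
have -> : 6%:R / y = 6 * 32 / c * (Num.sqrt n%:R)^-1.
  by rewrite /y; field; rewrite !gt_eqF.
have -> : n%:R ^+ 3 = Num.sqrt n%:R ^+ 6 :> R by rewrite -[in LHS]sE -exprM.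
by rewrite exprMn exprVn.
Qed.

Lemma two_powR_rate (n : nat) (d : R) : (2 <= n)%N -> 0 < d ->
  2 `^ (- (d * n%:R / 4)) <= (24 / d) ^+ 3 * (n%:R ^+ 3)^-1.
Proof.
move=> n2 d0; have n0 : 0 < n%:R :> R by rewrite ltr0n; apply: leq_trans n2.
have y0 : 0 < d * n%:R / 8 by rewrite divr_gt0// mulr_gt0.
apply: (@le_trans _ _ (expR (- (d * n%:R / 8)))).
  rewrite /powR gt_eqF//= ler_expR; have := ln2_ge; nra.
apply: (le_trans (expRN_pow_le 3 _ isT y0)).
have -> : 3%:R / (d * n%:R / 8) = 24 / d * n%:R^-1 by field; rewrite !gt_eqF.
by rewrite exprMn exprVn.
Qed.

Lemma expR_ln_rate (n : nat) : (2 <= n)%N -> expR (- (2 * (2 * ln n%:R))) <= (n%:R ^+ 3)^-1 :> R.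
Proof.
move=> n2; have n0 : 0 < n%:R :> R by rewrite ltr0n; apply: leq_trans n2.
have ln0 := ln_nat_ge n n2.
apply: (@le_trans _ _ (expR (- (3%:R * ln n%:R)))); first by rewrite ler_expR; lra.
by rewrite expRN expRM_natl lnK ?posrE.
Qed.

(** With X = |E||B|, eps = d / 4 and kappa^eps = d / 32, the exponents of 2 add up
    to at most n (kappa - d / 2 + d / 8), below - n d / 4. *)
Lemma few_common_balanced_rate (n : nat) (d kappa X : R) :
  0 < d <= 1 -> kappa <= d / 32 -> kappa `^ (d / 4) = d / 32 ->
  2 `^ (n%:R * (1 + d)) <= X ->
  2 `^ (n%:R * (1 + kappa)) * (X `^ (d / 4) * ((1 + kappa `^ (d / 4)) ^+ n) ^+ 2) <=
   X * 2 `^ (- (d * n%:R / 4)).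
Proof.
move=> /andP[d0 d1] kd -> HX.
have n0 : 0 <= n%:R :> R by [].
have X0 : 0 < X by apply: lt_le_trans HX; rewrite powR_gt0.
have two1 : 1 <= 2 :> R by lra.
have zb : ((1 + d / 32) ^+ n) ^+ 2 <= 2 `^ (n%:R * (d / 8)).
  have h : 1 + d / 32 <= 2 `^ (d / 16).
    apply: (le_trans (expR_ge1Dx (d / 32))).
    rewrite /powR gt_eqF//= ler_expR; have := ln2_ge; nra.
  rewrite -exprM mulnC exprM.
  have -> : n%:R * (d / 8) = d / 16 * 2%:R * n%:R by lra.
  rewrite powRrM powR_mulrn ?powR_ge0// powRrM powR_mulrn ?powR_ge0//.
  have d32 : 0 <= 1 + d / 32 by rewrite addr_ge0// divr_ge0// ltW.
  by apply: lerXn2r; rewrite ?nnegrE ?exprn_ge0 ?powR_ge0//; apply: lerXn2r; rewrite ?nnegrE ?powR_ge0.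
have Xb : X `^ (d / 4) <= X * 2 `^ (n%:R * (1 + d) * (d / 4 - 1)).
  have -> : d / 4 = 1 + (d / 4 - 1) by lra.
  rewrite powRD ?(gt_eqF X0) ?implybT// powRr1 ?(ltW X0)//.
  have -> : 1 + (d / 4 - 1) - 1 = d / 4 - 1 by lra.
  apply: ler_wpM2l; first exact: ltW.
  rewrite powRrM.
  have -> : d / 4 - 1 = - (1 - d / 4) by lra.
  rewrite !powRN lef_pV2 ?posrE ?powR_gt0//.
  by apply: ge0_ler_powR; rewrite ?nnegrE ?powR_ge0 ?(ltW X0)//; lra.
apply: (@le_trans _ _ (2 `^ (n%:R * (1 + kappa)) * ((X * 2 `^ (n%:R * (1 + d) * (d / 4 - 1))) * 2 `^ (n%:R * (d / 8))))).
  apply: ler_wpM2l; first exact: powR_ge0.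
  by apply: ler_pM => //; rewrite ?powR_ge0// exprn_ge0 ?exprn_ge0// addr_ge0// divr_ge0// ltW.
rewrite -mulrA mulrCA; apply: ler_wpM2l; first exact: ltW.
rewrite -!powRD ?pnatr_eq0 ?implybT//; apply: ler_powR => //.
have dd : 0 <= n%:R * (d * (1 - d)) by rewrite !mulr_ge0 ?(ltW d0)//; lra.
have := ler_wpM2l n0 kd; nra.
Qed.

Lemma exists_balance_threshold (d : R) : 0 < d <= 1 -> exists kappa : R,
  [/\ 0 < kappa, kappa <= d / 32 & kappa `^ (d / 4) = d / 32].
Proof.
move=> /andP[d0 d1]; exists ((d / 32) `^ (4 / d)).
have z0 : 0 < d / 32 by rewrite divr_gt0.
split; first exact: powR_gt0.
- apply: ge1r_powR; first by apply/andP; split; lra.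
  rewrite ler_pdivlMr//; lra.
- rewrite -powRrM.
  have -> : 4 / d * (d / 4) = 1 by field; rewrite gt_eqF.
  by rewrite powRr1// ltW.
Qed.

(** * From two-cubes and sign vectors to bit sequences *)

Lemma sum_decode {T : choiceType} n (dec : seq bool -> T) (X : {fset T}) (G : T -> R) :
  (forall s t : n.-tuple bool, dec s = dec t -> s = t) ->
  (forall x, x \in X -> exists s : n.-tuple bool, dec s = x) ->
  \sum_(s : n.-tuple bool) (dec s \in X)%:R * G (dec s) = \sum_(x <- X) G x.
Proof.
move=> inj sur.
rewrite [RHS](perm_big [seq dec (tval s) | s <- enum {: n.-tuple bool} & dec (tval s) \in X]).
  rewrite big_map big_filter big_enum_cond [RHS]big_mkcond/=.
  by apply: eq_bigr => s _; case: ifP; rewrite ?mul1r ?mul0r.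
apply: uniq_perm; first exact: fset_uniq.
  rewrite map_inj_in_uniq => [|s t _ _]; last exact: inj.
  by rewrite filter_uniq -?enumT ?enum_uniq.
move=> x; apply/idP/mapP => [xX|[s]]; last by rewrite mem_filter => /andP[sX _] ->.
by have [s sx] := sur x xX; exists s => //; rewrite mem_filter mem_enum sx xX.
Qed.

Definition decode n (a b : 'I_n -> int) (s : seq bool) : 'rV[int]_n :=
  \row_(j < n) (if nth false s j then a j else b j).

Lemma decode_inj n (a b : 'I_n -> int) : (forall j, a j != b j) ->
  forall s t : n.-tuple bool, decode n a b s = decode n a b t -> s = t.
Proof.
move=> ab s t /rowP E; apply: val_inj; apply: (@eq_from_nth _ false).
  by rewrite !size_tuple.
move=> i; rewrite size_tuple => ilt; have := E (Ordinal ilt); rewrite !mxE /=.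
have := ab (Ordinal ilt).
by case: (nth _ s i); case: (nth _ t i) => // + e; rewrite e eqxx.
Qed.

Lemma decode_surj n (a b : 'I_n -> int) (x : 'rV[int]_n) :
  (forall j, x 0 j \in [fset a j; b j]) -> exists s : n.-tuple bool, decode n a b s = x.
Proof.
move=> H; have sz : size [seq x 0 j == a j | j <- enum 'I_n] == n.
  by rewrite size_map size_enum_ord.
exists (Tuple sz).
apply/rowP => j; rewrite mxE /= (nth_map j) ?size_enum_ord// nth_ord_enum.
by have := H j; rewrite !inE; case: eqP => [->//|_ /= /eqP->].
Qed.

Lemma phase_sum (phi : seq R) y : size phi = size y ->
  phase phi y = \sum_(i < size phi) (if nth false y i then 1 else -1) * nth 0 phi i.
Proof.
elim: phi y => [|f phi IH] [|b y]//=; first by rewrite big_ord0.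
move=> [sz]; rewrite big_ord_recl/= IH//; congr (_ + _).
by case: b; rewrite ?mul1r ?mulN1r.
Qed.

Definition freq_pairs (p n : nat) (u v : 'I_n -> int) (a : 'F_p) : seq (R * R) :=
  [seq (freq p a (u j), freq p a (v j)) | j <- enum 'I_n].

Lemma phase_freq (p n : nat) (u v : 'I_n -> int) (a : 'F_p) (x y : n.-tuple bool) :
  phase (angles (freq_pairs p n u v a) x) y =
  freq p a (dot (decode n u v x) (decode n (fun=> 1) (fun=> -1) y)).
Proof.
have szp : size (freq_pairs p n u v a) = n by rewrite size_map size_enum_ord.
have sz : size (angles (freq_pairs p n u v a) x) = n.
  by rewrite size_map size_zip szp size_tuple minnn.
rewrite phase_sum ?sz ?size_tuple//.
have fsum (F : 'I_n -> int) : freq p a (\sum_j F j) = \sum_j freq p a (F j).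
  apply: (big_morph (freq p a) (freqD p a)).
  by rewrite /freq mulr0 mul0r mulr0.
rewrite /dot fsum; apply: eq_bigr => j _; rewrite !mxE.
rewrite (nth_map ((0, 0), false)) ?size_zip ?szp ?size_tuple ?minnn//.
rewrite nth_zip ?szp ?size_tuple//= (nth_map j) ?size_enum_ord// nth_ord_enum.
by case: (nth _ x j); case: (nth _ y j) => /=; rewrite ?mulr1 ?mulrN1 ?freqN ?mul1r ?mulN1r.
Qed.

(** A bound for all the inner products; a prime larger than 8 times this number
    turns the congruences modulo p that occur below into equalities. *)
Definition coord_bound n (u v : 'I_n -> int) : nat := (\sum_j (`|u j| + `|v j|))%N.

Lemma coord_le n (u v : 'I_n -> int) j : (`|u j| + `|v j| <= coord_bound n u v)%N.
Proof. by rewrite /coord_bound (bigD1 j)//= leq_addr. Qed.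

Lemma difference_le n (u v : 'I_n -> int) j :
  (`|difference u v j| <= coord_bound n u v)%N.
Proof. rewrite /difference; have := coord_le n u v j; lia. Qed.

Lemma dot_le n (u v : 'I_n -> int) (x y : 'rV[int]_n) :
  (forall j, x 0 j \in [fset u j; v j]) -> (forall j, y 0 j \in signs) ->
  (`|dot x y| <= coord_bound n u v)%N.
Proof.
move=> Hx Hy; rewrite /dot /coord_bound.
apply: (big_ind2 (fun (a : int) (b : nat) => (`|a| <= b)%N)) => // [a b c d|j _]; first lia.
have := Hx j; have := Hy j; rewrite !inE => /orP[]/eqP-> /orP[]/eqP->; lia.
Qed.

Lemma cos_sin_le (C S th : R) : C * cos th + S * sin th <= Num.sqrt (C ^+ 2 + S ^+ 2).
Proof.
have [neg|pos] := leP (C * cos th + S * sin th) 0.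
  by apply: (le_trans neg); exact: sqrtr_ge0.
rewrite -ler_sqr ?nnegrE ?sqrtr_ge0 ?(ltW pos)//.
rewrite sqr_sqrtr ?addr_ge0 ?sqr_ge0//.
have := cos2Dsin2 th; move: (cos th) (sin th) => c s h.
have -> : C ^+ 2 + S ^+ 2 = (C ^+ 2 + S ^+ 2) * (c ^+ 2 + s ^+ 2) by rewrite h mulr1.
have := sqr_ge0 (C * s - S * c); lra.
Qed.

(** Fourier inversion on F_p: as p exceeds the difference of any two inner
    products, the indicator of <x,y> = k is an average of characters. *)
Lemma prob_le_char (p n : nat) (u v : 'I_n -> int) (B : {fset 'rV[int]_n}) (x : n.-tuple bool) :
  prime p -> sign_vectors B -> (2 * coord_bound n u v < p)%N -> (0 < #|` B|)%N ->
  max_dot_prob R B (decode n u v x) * (p%:R * #|` B|%:R) <=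
  \sum_(a : 'F_p) char_norm n (angles (freq_pairs p n u v a) x)
     (fun s => (decode n (fun=> 1) (fun=> -1) s \in B)%:R).
Proof.
move=> p_pr sB Mp B0.
set w := fun s => _.
have [[k ->] _] := max_dot_probP R B (decode n u v x).
have B0' : #|` B|%:R != 0 :> R by rewrite pnatr_eq0 -lt0n.
rewrite /uniform_prob; set c := #|` [fset y in B | dot (decode n u v x) y == k]|.
have -> : c%:R / #|` B|%:R * (p%:R * #|` B|%:R) = p%:R * c%:R :> R by field.
have Hx j : (decode n u v x) 0 j \in [fset u j; v j].
  by rewrite mxE !inE; case: ifP; rewrite eqxx ?orbT.
have decY : forall y, y \in B -> exists s : n.-tuple bool, decode n (fun=> 1) (fun=> -1) s = y.
  by move=> y yB; apply: decode_surj => j; have := sB y yB j.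
have [c0|] := posnP c.
  by rewrite c0 mulr0; apply: sumr_ge0 => a _; exact: char_norm_ge0.
rewrite /c cardfs_gt0 => /fset0Pn[y0]; rewrite !inE => /andP[y0B /eqP y0k].
have cE : c%:R = \sum_(y <- B) (dot (decode n u v x) y == k)%:R :> R.
  rewrite -natr_sum; congr (_%:R); rewrite /c card_fset_sum1 -big_fset_condE.
  by rewrite [LHS]big_mkcond; apply: eq_bigr => y _; case: ifP.
rewrite cE mulr_sumr.
have orth y : y \in B -> p%:R * (dot (decode n u v x) y == k)%:R =
   \sum_(a : 'F_p) cos (freq p a (dot (decode n u v x) y - k)).
  move=> yB; have [->|ne] := eqVneq (dot (decode n u v x) y) k.
    by rewrite subrr sum_cos_freq0// mulr1.
  rewrite mulr0 sum_cos_freq ?subr_eq0//.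
  have := dot_le n u v _ _ Hx (sB y yB); have := dot_le n u v _ _ Hx (sB y0 y0B).
  rewrite y0k; lia.
rewrite big_seq (eq_bigr _ orth) -big_seq exchange_big/=; apply: ler_sum => a _.
pose G z y : R := z (freq p a (dot (decode n u v x) y)).
have inj := decode_inj n (fun=> 1) (fun=> -1) (fun=> isT).
have -> : \sum_(y <- B) cos (freq p a (dot (decode n u v x) y - k)) =
  (\sum_(y <- B) G (@cos R) y) * cos (freq p a k) + (\sum_(y <- B) G (@sin R) y) * sin (freq p a k).
  rewrite !mulr_suml -big_split/=; apply: eq_bigr => y _.
  by rewrite freqD freqN cosB.
rewrite -(sum_decode n _ _ (G (@cos R)) inj decY) -(sum_decode n _ _ (G (@sin R)) inj decY).
apply: le_trans (cos_sin_le _ _ _) _; rewrite le_eqVlt; apply/orP; left; apply/eqP.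
rewrite /char_norm /char_cos /char_sin; congr (Num.sqrt (_ ^+ 2 + _ ^+ 2));
  by apply: eq_bigr => y _; rewrite phase_freq.
Qed.

Lemma mask_sum_dispersion (p : nat) (m : seq bool) (ks : seq int) (a : 'F_p) :
  size m = size ks ->
  mask_sum m [seq 1 - cos (freq p a k) | k <- ks] = dispersion p (mask m ks) a.
Proof.
rewrite /mask_sum /dispersion; elim: m ks => [|b m IH] [|k ks]//=.
  by rewrite !big_nil.
move=> [/IH sz]; rewrite big_cons/= sz.
by case: b; rewrite /= ?big_cons ?mul1r ?mul0r ?add0r.
Qed.

(** The frequencies 2 d_j: two values of Y_j differ by 2, two values of x_j by
    d_j. *)
Definition steps n (u v : 'I_n -> int) : seq int := [seq 2 * difference u v j | j <- enum 'I_n].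

Lemma gaps_freq (p n : nat) (u v : 'I_n -> int) (a : 'F_p) :
  gaps (freq_pairs p n u v a) = [seq 1 - cos (freq p a k) | k <- steps n u v].
Proof.
rewrite /gaps /freq_pairs /steps -!map_comp; apply: eq_map => j /=.
by rewrite /difference mulrDr !mulr_natl !mulr2n; congr (1 - cos _); rewrite !freqD !freqN; ring.
Qed.

Lemma steps_bound n (u v : 'I_n -> int) : (forall j, u j != v j) ->
  forall k, k \in steps n u v -> k != 0 /\ (`|k| <= 2 * coord_bound n u v)%N.
Proof.
move=> uv k /mapP[j _ ->]; split.
  by rewrite mulf_neq0// subr_eq0.
have := difference_le n u v j; lia.
Qed.

Lemma frequency_average (p n r : nat) (J : seq int) (kappa lam : R) :
  prime p -> (2 <= n)%N -> 0 < kappa -> 0 < lam ->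
  (forall k, k \in J -> k != 0 /\ (`|k|%N < p)%N) ->
  kappa * n%:R <= (size J)%:R ->
  #|level p J ((size J)%:R / 4)|%:R * (size J)%:R ^+ (2 * r) <= 20 * p%:R * n%:R ^+ r :> R ->
  \sum_(a : 'F_p) expR (- (lam * dispersion p J a)) <=
  p%:R * (8 / p%:R + 640 / kappa ^+ (2 * r) * ((n%:R ^+ r)^-1 / Num.sqrt (lam * (kappa * n%:R)))
     + 2 * expR (- (lam * (kappa * n%:R) / 16))).
Proof.
move=> p_pr n2 k0 lam0 HJ Jbig HN.
have n0 : 0 < n%:R :> R by rewrite ltr0n; apply: leq_trans n2.
have p0 : 0 < p%:R :> R by rewrite ltr0n prime_gt0.
have kn : 0 < kappa * n%:R by rewrite mulr_gt0.
have J0 : 0 < (size J)%:R :> R by apply: lt_le_trans Jbig.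
apply: (le_trans (sum_expR_dispersion p J lam p_pr HJ _ lam0)).
  by rewrite -(ltr_nat R).
set N := #|_|%:R in HN *.
rewrite !mulrDr.
have -> : p%:R * (8 / p%:R) = 8 :> R by rewrite mulrCA divff ?mulr1// gt_eqF.
apply: lerD; last first.
  rewrite mulrCA mulrA; apply: ler_wpM2l; first by rewrite mulr_ge0 ?(ltW p0).
  rewrite ler_expR lerN2 ler_pM2r// ler_pM2l//.
rewrite lerD2l.
have s0 : 0 < Num.sqrt (lam * (kappa * n%:R)) by rewrite sqrtr_gt0 mulr_gt0.
have NB : N <= 20 * p%:R * (n%:R ^+ r)^-1 / kappa ^+ (2 * r).
  have kn2 : 0 < (kappa * n%:R) ^+ (2 * r) by rewrite exprn_gt0.
  have -> : 20 * p%:R * (n%:R ^+ r)^-1 / kappa ^+ (2 * r) =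
      20 * p%:R * n%:R ^+ r / (kappa * n%:R) ^+ (2 * r).
    have -> : (kappa * n%:R) ^+ (2 * r) = kappa ^+ (2 * r) * (n%:R ^+ r * n%:R ^+ r).
      by rewrite exprMn -exprD addnn mul2n.
    by field; rewrite !gt_eqF ?exprn_gt0.
  rewrite ler_pdivlMr//; apply: le_trans HN; apply: ler_wpM2l => //.
  by apply: lerXn2r; rewrite ?nnegrE ?(ltW kn) ?(ltW J0).
have -> : p%:R * (640 / kappa ^+ (2 * r) * ((n%:R ^+ r)^-1 / Num.sqrt (lam * (kappa * n%:R)))) =
  32 * (20 * p%:R * (n%:R ^+ r)^-1 / kappa ^+ (2 * r)) / Num.sqrt (lam * (kappa * n%:R)).
  by field; rewrite !gt_eqF ?exprn_gt0.
apply: ler_pM.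
- by rewrite mulr_ge0.
- by rewrite invr_ge0 sqrtr_ge0.
- by apply: ler_wpM2l.
- rewrite lef_pV2 ?posrE ?sqrtr_gt0 ?mulr_gt0// ler_sqrt ?mulr_ge0 ?(ltW lam0) ?(ltW J0)//.
  by rewrite ler_pM2l.
Qed.

(** * Bound on the exceptional set *)

Definition indic {T : choiceType} (dec : seq bool -> T) (X : {fset T})
  (s : seq bool) : R := (dec s \in X)%:R.

Lemma mass_indic {T : choiceType} n (dec : seq bool -> T) (X : {fset T}) :
  (forall s t : n.-tuple bool, dec s = dec t -> s = t) ->
  (forall x, x \in X -> exists s : n.-tuple bool, dec s = x) ->
  mass n (indic dec X) = #|` X|%:R.
Proof.
move=> inj sur.
rewrite card_fset_sum1 natr_sum -(sum_decode n dec X (fun=> 1) inj sur).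
by apply: eq_bigr => s _; rewrite mulr1.
Qed.

(** The bounds on the level sets are a hypothesis, stated for every sublist J
    of the steps, since J varies with the pair (x, y).  The exponent r is 0, 1 or
    2 in the three cases of the theorem. *)
Lemma threshold_le (p n r : nat) (E B : {fset 'rV[int]_n})
    (u v : 'I_n -> int) (kappa phi t T lam : R)
    (vE := indic (decode n u v) E)
    (wB := indic (decode n (fun=> 1) (fun=> -1)) B) :
  (2 <= n)%N -> 0 < kappa -> kappa <= 1 / 2 -> 1 <= T -> lam = kappa ^+ 2 / (96 * T) ->
  (forall j, u j != v j) ->
  (forall x, x \in E -> forall j, x 0 j \in [fset u j; v j]) ->
  sign_vectors B -> (0 < #|` B|)%N -> (0 < #|` E|)%N ->
  (forall x, x \in E -> t <= max_dot_prob R B x) ->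
  prime p -> (8 * coord_bound n u v < p)%N ->
  (\sum_(x : n.-tuple bool) \sum_(y : n.-tuple bool) vE x * wB y *
     ((count id (meet_mask (suffix_mask kappa vE x) (prefix_mask kappa wB y)))%:R
        < kappa * n%:R)%R%:R <= #|` E|%:R * #|` B|%:R * phi) ->
  (forall m : seq bool, size m = n -> forall J, J = mask m (steps n u v) ->
    #|level p J ((size J)%:R / 4)|%:R * (size J)%:R ^+ (2 * r) <= 20 * p%:R * n%:R ^+ r :> R) ->
  t <= expR 3 * (expR (- (2 * T)) + phi +
    (8 / p%:R + 640 / kappa ^+ (2 * r) * ((n%:R ^+ r)^-1 / Num.sqrt (lam * (kappa * n%:R)))
     + 2 * expR (- (lam * (kappa * n%:R) / 16)))).
Proof.
move=> n2 k0 k1 T1 lamE uv HE sB B0 E0 Ht p_pr Mp few lev.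
have Mp2 : (2 * coord_bound n u v < p)%N.
  by apply: leq_ltn_trans Mp; rewrite leq_mul2r orbT.
set Psi := 8 / _ + _ + _.
have p0 : 0 < p%:R :> R by rewrite ltr0n prime_gt0.
have T0 : 0 < T by apply: lt_le_trans T1.
have lam0 : 0 < lam by rewrite lamE; apply: divr_gt0; [exact: exprn_gt0 | exact: mulr_gt0].
have n0 : 0 < n%:R :> R by rewrite ltr0n; apply: leq_trans n2.
have vE0 s : 0 <= vE s by exact: ler0n.
have wB0 s : 0 <= wB s by exact: ler0n.
have injX := decode_inj n u v uv.
have injY := decode_inj n (fun=> 1) (fun=> -1) (fun=> isT).
have surX x : x \in E -> exists s : n.-tuple bool, decode n u v s = x.
  by move=> xE; apply: decode_surj => j; exact: HE.
have surY y : y \in B -> exists s : n.-tuple bool, decode n (fun=> 1) (fun=> -1) s = y.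
  by move=> yB; apply: decode_surj => j; have := sB y yB j.
have mV : mass n vE = #|` E|%:R by exact: mass_indic.
have mW : mass n wB = #|` B|%:R by exact: mass_indic.
have VW0 : 0 < p%:R * (#|` E|%:R * #|` B|%:R) :> R.
  by rewrite mulr_gt0// mulr_gt0 ?ltr0n.
rewrite -(ler_pM2r VW0).
have Psi0 : 0 <= Psi.
  apply: addr_ge0; first apply: addr_ge0.
  - by apply: divr_ge0 => //; exact: ltW.
  - apply: mulr_ge0; first by apply: divr_ge0; [exact: ler0n | exact/exprn_ge0/ltW].
    apply: divr_ge0; last exact: sqrtr_ge0.
    by rewrite invr_ge0; exact: exprn_ge0.
  - by rewrite mulr_ge0 ?expR_ge0.
pose Q (x y : seq bool) := meet_mask (suffix_mask kappa vE x) (prefix_mask kappa wB y).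
pose few_ind x y : R := ((count id (Q x y))%:R < kappa * n%:R)%R%:R.
have sizeQ (x y : n.-tuple bool) : size (Q x y) = n.
  by rewrite size_map size_zip size_suffix_mask size_prefix_mask !size_tuple minnn.
have size_steps : size (steps n u v) = n by rewrite size_map size_enum_ord.
have pair_bound (x y : n.-tuple bool) :
    \sum_(a : 'F_p) expR (- (lam * mask_sum (Q x y) (gaps (freq_pairs p n u v a)))) <=
    p%:R * few_ind x y + p%:R * Psi.
  have dE (a : 'F_p) : mask_sum (Q x y) (gaps (freq_pairs p n u v a)) =
     dispersion p (mask (Q x y) (steps n u v)) a.
    by rewrite gaps_freq mask_sum_dispersion// sizeQ size_steps.
  under eq_bigr do rewrite dE.
  rewrite /few_ind; case: ltP => [_|big].
    rewrite mulr1 -[leLHS]addr0; apply: lerD; last by rewrite mulr_ge0 ?(ltW p0).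
    have <- : \sum_(a : 'F_p) 1 = p%:R :> R by rewrite sumr_const card_Fp.
    apply: ler_sum => a _; rewrite expR_le1 oppr_le0.
    by rewrite mulr_ge0 ?dispersion_ge0 ?(ltW lam0).
  rewrite mulr0 add0r; apply: frequency_average => //.
  - move=> k /mem_mask /steps_bound -/(_ uv)[kn0 kM]; split=> //.
    exact: leq_ltn_trans kM Mp2.
  - by rewrite size_mask ?sizeQ.
  - by apply: (lev (Q x y)); rewrite ?sizeQ.
have avg (a : 'F_p) := char_norm_average_le n kappa T (freq_pairs p n u v a) vE wB
  ltac:(by rewrite (ltW k0)) T1 ltac:(by rewrite size_map size_enum_ord) vE0 wB0.
have step1 : t * (p%:R * (#|` E|%:R * #|` B|%:R)) <=
   \sum_(a : 'F_p) \sum_(x : n.-tuple bool) vE x * char_norm n (angles (freq_pairs p n u v a) x) wB.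
  rewrite exchange_big/=.
  have -> : t * (p%:R * (#|` E|%:R * #|` B|%:R)) =
     \sum_(x : n.-tuple bool) vE x * (t * (p%:R * #|` B|%:R)).
    by rewrite -mulr_suml -/(mass n vE) mV; ring.
  apply: ler_sum => x _; rewrite -mulr_sumr /vE /indic.
  case: (boolP (_ \in E)) => [xE|_]; last by rewrite !mul0r.
  rewrite !mul1r.
  apply: le_trans (prob_le_char p n u v B x p_pr sB Mp2 B0).
  by apply: ler_wpM2r; [rewrite mulr_ge0 ?(ltW p0) | exact: Ht].
apply: (le_trans step1).
apply: (le_trans (ler_sum _ (fun a _ => avg a))).
rewrite -mulr_sumr -[leRHS]mulrA; apply: ler_wpM2l; first exact: expR_ge0.
rewrite big_split/= sumr_const card_Fp// -[_ *+ p]mulr_natl mV mW -lamE.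
have -> : (expR (- (2 * T)) + phi + Psi) * (p%:R * (#|` E|%:R * #|` B|%:R)) =
  p%:R * (#|` E|%:R * #|` B|%:R * expR (- (2 * T))) +
  (p%:R * (#|` E|%:R * #|` B|%:R * phi) + p%:R * Psi * (#|` E|%:R * #|` B|%:R)) by ring.
rewrite lerD2l exchange_big/=.
apply: (@le_trans _ _ (\sum_(x : n.-tuple bool) \sum_(y : n.-tuple bool)
   vE x * wB y * (p%:R * few_ind x y + p%:R * Psi))).
  apply: ler_sum => x _; rewrite exchange_big/=; apply: ler_sum => y _.
  by rewrite -mulr_sumr; apply: ler_wpM2l; [rewrite mulr_ge0 | exact: pair_bound].
have -> : \sum_(x : n.-tuple bool) \sum_(y : n.-tuple bool)
   vE x * wB y * (p%:R * few_ind x y + p%:R * Psi) =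
  p%:R * (\sum_(x : n.-tuple bool) \sum_(y : n.-tuple bool) vE x * wB y * few_ind x y) +
  p%:R * Psi * (mass n vE * mass n wB).
  rewrite mulr_sumr /mass mulr_suml mulr_sumr -big_split/=; apply: eq_bigr => x _.
  rewrite !mulr_sumr -big_split/=; apply: eq_bigr => y _; ring.
rewrite mV mW lerD2r; apply: ler_wpM2l; [exact: ltW | exact: few].
Qed.

(** If the set were larger, [few_common_balanced] would apply to it and
    [threshold_le] would bound the threshold by less than its value. *)
Lemma card_exceptional_le (beta delta : R) : 0 < delta ->
  exists2 C : R, 0 < C &
    forall (n r : nat) (A B : {fset 'rV[int]_n}) (u v : 'I_n -> int),
      (2 <= n)%N -> (r <= 2)%N -> two_cube A u v -> sign_vectors B ->
      #|` B|%:R = 2 `^ (beta * n%:R) ->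
      (forall p, prime p -> (8 * coord_bound n u v < p)%N ->
        forall m : seq bool, size m = n -> forall J, J = mask m (steps n u v) ->
        #|level p J ((size J)%:R / 4)|%:R * (size J)%:R ^+ (2 * r)
          <= 20 * p%:R * n%:R ^+ r :> R) ->
      #|` exceptional A B (C * Num.sqrt (ln n%:R) * n%:R `^ (- (r%:R + 1 / 2)))|%:R
            <= 2 `^ (n%:R * (1 - beta + delta)).
Proof.
move=> delta0.
(* The statement is stronger for smaller delta, and the choice of kappa needs
   delta at most 1. *)
pose d := Num.min delta 1.
have d0 : 0 < d by rewrite lt_min delta0 ltr01.
have d1 : d <= 1 by rewrite ge_min lexx orbT.
have dd : d <= delta by rewrite ge_min lexx.
have db : 0 < d <= 1 by rewrite d0 d1.
have [kappa [k0 kd kE]] := exists_balance_threshold d db.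
have k1 : kappa <= 1 / 2 by lra.
(* The decay exponent is c n / ln n with c independent of n. *)
have [c [c0 cE]] : exists c, 0 < c /\ forall l N : R, l != 0 ->
    kappa ^+ 2 / (96 * (2 * l)) * (kappa * N) = c / l * N.
  exists (kappa ^+ 3 / 192); split; first by apply: divr_gt0; [exact: exprn_gt0 | rewrite ltr0n].
  by move=> l N l0; field.
pose K := 640 / kappa ^+ 4 * (Num.sqrt c)^-1.
pose C := expR 3 * (1 + (24 / d) ^+ 3 + 8 + K + 2 * (6 * 32 / c) ^+ 6) + 1.
have K0 : 0 <= K.
  apply: mulr_ge0; first by apply: divr_ge0; [exact: ler0n | exact/exprn_ge0/ltW].
  by rewrite invr_ge0; exact: sqrtr_ge0.
have q0 : 0 <= (24 / d) ^+ 3 by apply: exprn_ge0; apply: divr_ge0 => //; exact: ltW.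
have q1 : 0 <= (6 * 32 / c) ^+ 6.
  by apply: exprn_ge0; apply: divr_ge0; [exact: mulr_ge0 | exact: ltW].
have C1 : 1 <= C.
  rewrite lerDr; apply: mulr_ge0; [exact: expR_ge0 | lra].
exists C; first by apply: lt_le_trans C1.
move=> n r A B u v n2 r2 [uv AE] sB cB lev.
have n0 : 0 < n%:R :> R by rewrite ltr0n; apply: leq_trans n2.
rewrite leNgt; apply/negP.
pose rate : R := Num.sqrt (ln n%:R) * n%:R `^ (- (r%:R + 1 / 2)).
rewrite -[C * _ * _]mulrA -/rate.
set E := exceptional A B _ => big.
have B0 : (0 < #|` B|)%N by rewrite -(ltr_nat R) cB powR_gt0.
have E0 : (0 < #|` E|)%N.
  by rewrite -(ltr_nat R); apply: lt_trans big; rewrite powR_gt0.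
have HE x : x \in E -> forall j, x 0 j \in [fset u j; v j].
  by rewrite !inE => /andP[]; rewrite AE => /forallP.
have Ht x : x \in E -> C * rate <= max_dot_prob R B x.
  by rewrite !inE -ltNge => /andP[_ /ltW].
(* The term n ^ 3 makes 8 / p an error term of size n^(-3). *)
have [p pbig p_pr] := prime_above (8 * coord_bound n u v + n ^ 3).
have Mp : (8 * coord_bound n u v < p)%N by apply: leq_ltn_trans pbig; exact: leq_addr.
have np : (n ^ 3 <= p)%N by apply: leq_trans (ltnW pbig); exact: leq_addl.
have ln0 := ln_nat_ge n n2.
pose vE := indic (decode n u v) E.
pose wB := indic (decode n (fun=> 1) (fun=> -1)) B.
have EB : 2 `^ (n%:R * (1 + d)) <= #|` E|%:R * #|` B|%:R :> R.
  rewrite cB; apply: (@le_trans _ _ (2 `^ (n%:R * (1 - beta + delta)) * 2 `^ (beta * n%:R))).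
    rewrite -powRD ?pnatr_eq0 ?implybT//; apply: ler_powR; first lra.
    by have := ler_wpM2l (ltW n0) dd; lra.
  by apply: ler_wpM2r; [exact: powR_ge0 | exact: ltW].
have mV : mass n vE = #|` E|%:R.
  apply: mass_indic; first exact: decode_inj.
  by move=> x xE; apply: decode_surj => j; exact: HE.
have mW : mass n wB = #|` B|%:R.
  apply: mass_indic; first exact: decode_inj.
  by move=> y yB; apply: decode_surj => j; have := sB y yB j.
have few : \sum_(x : n.-tuple bool) \sum_(y : n.-tuple bool) vE x * wB y *
     ((count id (meet_mask (suffix_mask kappa vE x) (prefix_mask kappa wB y)))%:R
        < kappa * n%:R)%R%:R <= #|` E|%:R * #|` B|%:R * 2 `^ (- (d * n%:R / 4)).
  apply: le_trans (few_common_balanced_rate n d kappa _ db kd kE EB).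
  rewrite -mV -mW; apply: few_common_balanced.
  - exact: ltW.
  - by apply/andP; split; lra.
  - by move=> s; rewrite /vE /indic; case: (_ \in _); [right | left].
  - by move=> s; rewrite /wB /indic; case: (_ \in _); [right | left].
have := threshold_le p n r E B u v kappa _ (C * rate) (2 * ln n%:R) _ n2 k0 k1
  ltac:(lra) erefl uv HE sB B0 E0 Ht p_pr Mp few (lev p p_pr Mp).
rewrite cE; last by apply/lt0r_neq0; lra.
apply/negP; rewrite -ltNge.
have rr : r%:R + 1 / 2 <= 5 / 2 :> R.
  by have : r%:R <= 2%:R :> R by [rewrite ler_nat]; lra.
have cube := natpow3_le_rate n _ n2 rr; rewrite -/rate in cube.
have cube0 : 0 < (n%:R ^+ 3)^-1 :> R by rewrite invr_gt0 exprn_gt0.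
have rate0 : 0 < rate by apply: lt_le_trans cube.
have b1 := expR_ln_rate n n2.
have b2 := two_powR_rate n d n2 d0.
have b3 : 8 / p%:R <= 8 * (n%:R ^+ 3)^-1 :> R.
  apply: ler_wpM2l; first exact: ler0n.
  have p0 : 0 < p%:R :> R by rewrite ltr0n prime_gt0.
  by rewrite lef_pV2 ?posrE ?exprn_gt0// -natrX ler_nat.
have b4 : 640 / kappa ^+ (2 * r) * ((n%:R ^+ r)^-1 / Num.sqrt (c / ln n%:R * n%:R)) <= K * rate.
  rewrite main_term_rate// -/rate [leLHS]mulrA /K.
  apply: ler_wpM2r; first exact: (ltW rate0).
  apply: ler_wpM2r; first by rewrite invr_ge0 sqrtr_ge0.
  apply: ler_wpM2l; first exact: ler0n.
  rewrite lef_pV2 ?posrE ?exprn_gt0//.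
  by apply: ler_wiXn2l; [exact: ltW | lra | exact: (@leq_mul 2 r 2 2)].
have b5 := exp_term_rate n c n2 c0.
apply: (@le_lt_trans _ _ (expR 3 * (1 + (24 / d) ^+ 3 + 8 + K + 2 * (6 * 32 / c) ^+ 6) * rate)).
  rewrite -[leRHS]mulrA; apply: ler_wpM2l; first exact: expR_ge0.
  have g2 := ler_wpM2l q0 cube; have g5 := ler_wpM2l q1 cube.
  lra.
by rewrite /C [ltRHS]mulrDl mul1r ltrDl.
Qed.

End HalaszTwoCubes.

Theorem theorem2 (R : realType) (beta delta : R)
    (beta_gt0 : 0 < beta) (delta_gt0 : 0 < delta) :
  exists2 C : R, 0 < C &
    forall (n : nat) (A B : {fset 'rV[int]_n}) (u v : 'I_n -> int),
      (2 <= n)%N ->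
      two_cube A u v ->
      sign_vectors B ->
      #|` B|%:R = 2 `^ (beta * n%:R) ->
      [/\ #|` exceptional A B
               (C * Num.sqrt (ln n%:R) * n%:R `^ (- (1 / 2)))|%:R
            <= 2 `^ (n%:R * (1 - beta + delta)),
          injective (difference u v) ->
          #|` exceptional A B
               (C * Num.sqrt (ln n%:R) * n%:R `^ (- (3 / 2)))|%:R
            <= 2 `^ (n%:R * (1 - beta + delta))
        & #|` [fset difference u v j | j : 'I_n]| = n ->
          weak_sidon [fset difference u v j | j : 'I_n] ->
          #|` exceptional A B
               (C * Num.sqrt (ln n%:R) * n%:R `^ (- (5 / 2)))|%:R
            <= 2 `^ (n%:R * (1 - beta + delta))].
Proof.
have [C C0 HC] := card_exceptional_le R beta delta delta_gt0.
exists C => // n A B u v n2 cube sB cB.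
have uv : forall j, u j != v j by case: cube.
have size_mask_le (m : seq bool) (s : seq int) : size s = n -> (size (mask m s) <= n)%N.
  by move=> <-; apply: size_subseq; exact: mask_subseq.
have size_steps : size (steps n u v) = n by rewrite size_map size_enum_ord.
have stepsE : steps n u v = [seq 2 * k | k <- [seq difference u v j | j <- enum 'I_n]].
  by rewrite -map_comp.
have mul2_inj : injective (fun k : int => 2 * k) by exact: mulfI.
split.
- have := HC n 0%N A B u v n2 isT cube sB cB.
  rewrite add0r; apply => p p_pr _ m _ J _.
  rewrite muln0 !expr0 !mulr1.
  apply: (@le_trans _ _ p%:R); last by rewrite ler_peMl// ler1n.
  by rewrite ler_nat; apply: leq_trans (max_card _) _; rewrite card_Fp.
- move=> inj; have := HC n 1%N A B u v n2 isT cube sB cB.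
  have -> : 1%:R + 1 / 2 = 3 / 2 :> R by lra.
  apply => p p_pr Mp m sm J JE.
  rewrite muln1 expr1.
  have uJ : uniq J.
    rewrite JE; apply: mask_uniq.
    by rewrite stepsE (map_inj_uniq mul2_inj) (map_inj_uniq inj) enum_uniq.
  have JM k : k \in J -> (`|k| <= 2 * coord_bound n u v)%N.
    by rewrite JE => /mem_mask /steps_bound -/(_ uv)[].
  apply: le_trans (card_level_uniq R p J (2 * coord_bound n u v)%N p_pr uJ JM _) _.
    by apply: leq_ltn_trans Mp; rewrite mulnA leq_mul2r orbT.
  have : (size J)%:R <= n%:R :> R by rewrite ler_nat JE size_mask_le.
  have := ler0n R p; have := ler0n R n => n0 p0 Jn.
  have := ler_wpM2l p0 Jn; have := mulr_ge0 p0 n0; lra.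
- move=> cS sid; have := HC n 2%N A B u v n2 isT cube sB cB.
  have -> : 2%:R + 1 / 2 = 5 / 2 :> R by lra.
  apply => p p_pr Mp m sm J JE.
  set S := [fset difference u v j | j : 'I_n] in cS sid.
  have inj : injective (difference u v).
    apply/injectiveP; apply: (@leq_size_uniq _ S) => //.
      by move=> _ /imfsetP[j _ ->]; apply: map_f; rewrite mem_enum.
    by rewrite size_map size_enum_ord cS.
  pose J0 := mask m [seq difference u v j | j <- enum 'I_n].
  have JJ0 : J = [seq 2 * k | k <- J0] by rewrite JE stepsE -map_mask.
  have uJ0 : uniq J0 by apply: mask_uniq; rewrite (map_inj_uniq inj) enum_uniq.
  have sJ0 : {subset J0 <= S}.
    by move=> k /mem_mask /mapP[j _ ->]; apply/imfsetP; exists j.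
  have J0M k : k \in J0 -> (`|k| <= coord_bound n u v)%N.
    by move=> /mem_mask /mapP[j _ ->]; exact: difference_le.
  apply: le_trans (card_level_sidon R p S J0 (coord_bound n u v) p_pr uJ0 sJ0 J0M Mp J JJ0) _.
  have : #|sidon_solutions S|%:R <= 100%:R * n%:R ^+ 2 :> R.
    by rewrite -natrX -natrM ler_nat; move: sid; rewrite /weak_sidon cS.
  have := ler0n R p => p0 h; have := ler_wpM2l p0 h; lra.
Qed.
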